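(* Let $G$ be a connected, simply connected complex unipotent Lie group with Lie algebra $\mathfrak{g}$, and let $V,H\subset G$ be complex algebraic subgroups such that the $V\times H$-action on $G$ given by $(v,h).g=vgh^{-1}$ is free. If $\mathfrak{g}$ is $3$-step nilpotent, then the $V\times H$-action on $G$ is proper.
   Context: A complex unipotent Lie group is an algebraic subgroup of a group of (unipotent) upper triangular complex matrices. The descending central series is $\mathfrak{g}^{(0)}=\mathfrak{g}$, $\mathfrak{g}^{(j+1)}=[\mathfrak{g},\mathfrak{g}^{(j)}]$. A nilpotent Lie algebra $\mathfrak{g}$ is $l$-step nilpotent if $l$ is the smallest integer with $\mathfrak{g}^{(l)}=\{0\}$. An action of a Lie group $L$ on $X$ is proper if the map $L\times X\to X\times X$, $(g,x)\mapsto(x,g.x)$, is proper, i.e. preimages of compact sets are compact (in the Euclidean topology). *)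

(* Defs.v *)
(* The field of complex numbers is R[i] for R : realType,
   and groups are subsets of the square matrices 'M[R[i]]_n.                  *)
From HB Require Import structures.
From mathcomp Require Import all_boot all_order all_algebra.
From mathcomp Require Import complex.
From mathcomp Require mpoly.
From mathcomp Require Import all_classical all_reals all_analysis.

Set Implicit Arguments.
Unset Strict Implicit.
Unset Printing Implicit Defensive.

Import Order.TTheory GRing.Theory Num.Theory.
Import numFieldNormedType.Exports.

Local Open Scope classical_set_scope.
Local Open Scope ring_scope.
Local Open Scope complex_scope.

(* R[i] carries the Euclidean topology, given by the modulus; the topologies of
   'M[R[i]]_n and of products then follow from the library.                   *)
HB.instance Definition _ (R : realType) := PseudoMetric.copy R[i] R[i]^o.
HB.instance Definition _ (R : realType) := Pointed.copy R[i] R[i]^o.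
HB.instance Definition _ (R : realType) := NormedModule.copy R[i] R[i]^o.

(* [f] is a map from the subspace [A] to the subspace [B]; its values outside
   [A] are irrelevant.                                                        *)
Definition proper_map (T U : topologicalType) (A : set T) (B : set U)
    (f : T -> U) : Prop :=
  forall K : set U, K `<=` B -> compact K -> compact (A `&` f @^-1` K).

Definition proper_action (T U : topologicalType) (L : set T) (X : set U)
    (act : T -> U -> U) : Prop :=
  proper_map (L `*` X) (X `*` X) (fun p : T * U => (p.2, act p.1 p.2)).

Definition free_action (T U : Type) (e : T) (L : set T) (X : set U)
    (act : T -> U -> U) : Prop :=
  forall g x, L g -> X x -> act g x = x -> g = e.

(* Triviality of the fundamental group at every base point; (path)
   connectedness is not part of this definition.                              *)
Definition simply_connected (R : realType) (T : topologicalType)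
    (A : set T) : Prop :=
  forall gamma : R -> T,
    {within `[0, 1]%classic, continuous gamma} ->
    (forall s, 0 <= s <= 1 -> A (gamma s)) ->
    gamma 0 = gamma 1 ->
  exists F : R * R -> T,
    [/\ {within `[0, 1]%classic `*` `[0, 1]%classic, continuous F},
        forall s t, 0 <= s <= 1 -> 0 <= t <= 1 -> A (F (s, t)),
        forall s, 0 <= s <= 1 -> F (s, 0) = gamma s,
        forall s, 0 <= s <= 1 -> F (s, 1) = gamma 0 &
        forall t, 0 <= t <= 1 -> F (0, t) = gamma 0 /\ F (1, t) = gamma 0].

Definition upper_unitriangular (R : realType) (n : nat) : set 'M[R[i]]_n :=
  [set A | forall i j : 'I_n, (j <= i)%N -> A i j = (i == j)%:R].

(* [mpoly.mpoly (n * n) R[i]] is the type {mpoly R[i][n * n]} of polynomials in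
   the n^2 matrix entries, and [mpoly.meval] is evaluation.                   *)
Definition algebraic_set (R : realType) (n : nat) (Z : set 'M[R[i]]_n) : Prop :=
  exists P : set (mpoly.mpoly (n * n) R[i]),
    Z = [set A | forall p, P p -> mpoly.meval (fun k => mxvec A 0 k) p = 0].

Definition algebraic_subgroup (R : realType) (n : nat)
    (H G : set 'M[R[i]]_n) : Prop :=
  [/\ H `<=` G,
      algebraic_set H,
      H 1%:M,
      forall A B, H A -> H B -> H (A *m B) &
      forall A, H A -> H (invmx A)].

Definition unipotent_lie_group (R : realType) (n : nat)
    (G : set 'M[R[i]]_n) : Prop :=
  algebraic_subgroup G (@upper_unitriangular R n).

Definition mexp (R : realType) (n : nat) (X : 'M[R[i]]_n) : 'M[R[i]]_n :=
  limn (series (fun k : nat => (k`!%:R)^-1 *: X ^+ k)).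

(* The generators of the holomorphic one-parameter subgroups of [G].          *)
Definition lie_algebra (R : realType) (n : nat) (G : set 'M[R[i]]_n) :
    set 'M[R[i]]_n :=
  [set X | forall t : R[i], G (mexp (t *: X))].

Definition lie_bracket (R : realType) (n : nat) (X Y : 'M[R[i]]_n) :
    'M[R[i]]_n :=
  X *m Y - Y *m X.

Definition linear_span (R : realType) (n : nat) (S : set 'M[R[i]]_n) :
    set 'M[R[i]]_n :=
  [set X | exists2 s : seq 'M[R[i]]_n, [set` s] `<=` S & X \in << s >>%VS].

Fixpoint descending_central_series (R : realType) (n : nat)
    (g : set 'M[R[i]]_n) (j : nat) : set 'M[R[i]]_n :=
  if j is j'.+1 then
    linear_span [set Z | exists X Y, [/\ g X,
      descending_central_series g j' Y & Z = lie_bracket X Y]]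
  else g.

Definition step_nilpotent (R : realType) (n : nat) (l : nat)
    (g : set 'M[R[i]]_n) : Prop :=
  descending_central_series g l = [set 0] /\
  forall j, descending_central_series g j = [set 0] -> (l <= j)%N.

Definition two_sided_act (R : realType) (n : nat)
    (vh : 'M[R[i]]_n * 'M[R[i]]_n) (g : 'M[R[i]]_n) : 'M[R[i]]_n :=
  vh.1 *m g *m invmx vh.2.

(* Main.v *)
From HB Require Import structures.
Require Import Defs.
From mathcomp Require Import all_boot all_order all_algebra.
From mathcomp Require Import complex.
From mathcomp Require mpoly.
From mathcomp Require Import all_classical all_reals all_analysis.
From mathcomp Require Import ring zify.
Import numFieldNormedType.Exports.

(** A compact set of pairs (g, g') yields points with v g = g' h.  Along an
    ultrafilter on these points g and g' converge; writing v = exp X, h = exp Y,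
    it is enough to show that X stays bounded.  With exp (2 D) = g'^-1 g and the
    midpoint m = g' exp D, the symmetric Baker-Campbell-Hausdorff formula turns
    v g = g' h into
      Y = X' + 2 D + ([X', [X', D]] - [D, [D, X']]) / 6,   X' = Ad(m^-1) X.
    The term quadratic in X is the obstruction.  Modulo the second centre
    Y = X + 2 D, so one may choose L in v and YL in h depending linearly on D
    with YL = L + 2 D modulo the second centre, and write X = xi + L.  The
    triple brackets of v and of h then give
      [X, [X, D]] - [D, [D, X]] = 3/2 [xi, [L, D]] + bounded + central terms
    with the central terms in v + h, and [xi, [L, D]] is absorbed by an inner
    automorphism with bounded parameter: Y - ch = Ad(z) (xi + cv) + bounded,
    with cv in v and ch in h central.  Freeness means that
    (A, B) |-> B - Ad(z) A is injective on v x h, which bounds xi + cv and then,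
    comparing Y - X, the central element cv. *)
Set Implicit Arguments.
Unset Strict Implicit.
Unset Printing Implicit Defensive.
Import Order.TTheory GRing.Theory Num.Theory.
Local Open Scope classical_set_scope.
Local Open Scope ring_scope.
Local Open Scope complex_scope.

(** * Brackets, and exponentials of strictly upper triangular matrices *)

HB.lock Definition br (A : pzRingType) (x y : A) : A := x * y - y * x.

Section Bracket.
Variable A : pzRingType.
Implicit Types x y z : A.

Lemma brE x y : br x y = x * y - y * x.
Proof. by rewrite br.unlock. Qed.

Lemma brDl x y z : br (x + y) z = br x z + br y z.
Proof. by rewrite !brE mulrDl mulrDr opprD addrACA. Qed.
Lemma brDr x y z : br x (y + z) = br x y + br x z.
Proof. by rewrite !brE mulrDl mulrDr opprD addrACA. Qed.
Lemma brNl x y : br (- x) y = - br x y.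
Proof. by rewrite !brE mulNr mulrN opprD. Qed.
Lemma brNr x y : br x (- y) = - br x y.
Proof. by rewrite !brE mulNr mulrN opprD. Qed.
Lemma br0l x : br 0 x = 0.
Proof. by rewrite !brE mul0r mulr0 subr0. Qed.
Lemma br0r x : br x 0 = 0.
Proof. by rewrite !brE mul0r mulr0 subr0. Qed.
Lemma brxx x : br x x = 0.
Proof. by rewrite brE subrr. Qed.
Lemma brC x y : br x y = - br y x.
Proof. by rewrite !brE opprB. Qed.
Lemma mul_br x y : x * y = y * x + br x y.
Proof. by rewrite !brE addrC subrK. Qed.
Lemma brMr x y z : br x (y * z) = br x y * z + y * br x z.
Proof. by rewrite !brE mulrBl mulrBr !mulrA subrKA. Qed.
Lemma jacobi x y z : br x (br y z) = br (br x y) z + br y (br x z).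
Proof.
by rewrite [br y z]brE [LHS]brDr brNr !brMr [br x z * y + _]addrC opprD addrACA
  (brE (br x y)) (brE y (br x z)).
Qed.

(** Left multiplication by [x] is right multiplication by [x] plus [ad x], and these two commute.
    The binomial formula then applies, cut after the square of [ad x]. *)
Lemma expr_br x y k : br x (br x (br x y)) = 0 ->
  x ^+ k * y = y * x ^+ k + br x y * x ^+ k.-1 *+ k
     + br x (br x y) * x ^+ k.-2 *+ 'C(k, 2).
Proof.
move=> h; set u := br x y; set w := br x u.
have e2 : x * w = w * x by rewrite mul_br h addr0.
have e1 : x * u = u * x + w by exact: mul_br.
have e0 : x * y = y * x + u by exact: mul_br.
clearbody w u.
elim: k => [|k IHk]; first by rewrite !mulr0n !addr0 mulr1 mul1r.
rewrite exprS -mulrA IHk !mulrDr !mulrnAr !mulrA e2 e1 e0 !mulrDl !mulrnDl.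
rewrite binS bin1 /= [_ *+ k.+1]mulrSr [_ *+ (_ + k)]mulrnDr -!mulrA -!exprS -!addrA; congr (_ + _).
case: k {IHk} => [|k]; first by rewrite !mulr0n !addr0 add0r.
rewrite addrCA; congr (_ + _); congr (_ + _).
case: k => [|k]; first by rewrite !mulr0n addr0 add0r.
by rewrite [RHS]addrC.
Qed.
(** The truncated differences [k - l] do no harm, as ['C(k, l)] vanishes for [k < l]. In this form
    each term can be summed by [nexp_shift]. *)
Lemma expr_br_bin x y k : br x (br x (br x y)) = 0 ->
  x ^+ k * y = y * x ^+ (k - 0) *+ 'C(k, 0) + br x y * x ^+ (k - 1) *+ 'C(k, 1)
     + br x (br x y) * x ^+ (k - 2) *+ 'C(k, 2).
Proof. by move=> h; rewrite subn2 subn1 subn0 bin0 bin1 expr_br. Qed.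
End Bracket.

(* The exponential series truncated at the size of the matrix; it is the
   exponential of strictly upper triangular matrices. *)
HB.lock Definition nexp (K : comUnitRingType) (m : nat) (X : 'M[K]_m.+1) :
  'M[K]_m.+1 := \sum_(k < m.+1) (k`!%:R^-1 : K) *: X ^+ k.

(** * Filtration by superdiagonals and the nilpotent exponential *)

Section Level.
Variables (K : comUnitRingType) (m : nat).
Hypothesis unitK : forall k, k.+1%:R \is a @GRing.unit K.
Implicit Types X Y : 'M[K]_m.+1.

(** Level 1 is strict upper triangularity; levels add under products, and a level above [m] forces
    zero. *)
Definition lev k X := forall i j : 'I_m.+1, (j < i + k)%N -> X i j = 0.

Lemma lev_le k l X : (k <= l)%N -> lev l X -> lev k X.
Proof.
by move=> le h i j hij; apply: h; apply: (leq_trans hij); rewrite leq_add2l.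
Qed.
Lemma lev0 k : lev k 0.
Proof. by move=> i j _; rewrite mxE. Qed.
Lemma lev_one : lev 0 1.
Proof. by move=> i j; rewrite addn0 mxE => /gtn_eqF h; rewrite -val_eqE /= h. Qed.
Lemma levD k X Y : lev k X -> lev k Y -> lev k (X + Y).
Proof. by move=> hX hY i j h; rewrite mxE hX ?hY ?addr0. Qed.
Lemma levN k X : lev k X -> lev k (- X).
Proof. by move=> hX i j h; rewrite mxE hX ?oppr0. Qed.
Lemma levB k X Y : lev k X -> lev k Y -> lev k (X - Y).
Proof. by move=> hX hY; apply/levD/levN. Qed.
Lemma levZ k a X : lev k X -> lev k (a *: X).
Proof. by move=> hX i j h; rewrite mxE hX ?mulr0. Qed.
Lemma levMn k a X : lev k X -> lev k (X *+ a).
Proof. by move=> hX; elim: a => [|a IH]; [exact: lev0 | rewrite mulrS; exact: levD]. Qed.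
Lemma levM k l X Y : lev k X -> lev l Y -> lev (k + l) (X * Y).
Proof.
move=> hX hY i j h; rewrite mxE big1 // => s _.
have [hs|hs] := ltnP s (i + k); first by rewrite hX ?mul0r.
rewrite (hY s) ?mulr0 //; apply: (leq_trans h).
by rewrite addnA leq_add2r.
Qed.
Lemma levX k X : lev 1 X -> lev k (X ^+ k).
Proof.
move=> h; elim: k => [|k IH]; first exact: lev_one.
by rewrite exprS -add1n; apply: levM.
Qed.
Lemma lev_br k l X Y : lev k X -> lev l Y -> lev (k + l) (br X Y).
Proof. by move=> hX hY; rewrite brE; apply: levB; [|rewrite addnC]; apply: levM. Qed.
Lemma lev_br1 X Y : lev 1 X -> lev 1 Y -> lev 1 (br X Y).
Proof. by move=> hX hY; apply: lev_le (lev_br hX hY). Qed.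
Lemma lev_eq0 k X : (m < k)%N -> lev k X -> X = 0.
Proof.
move=> hk hX; apply/matrixP => i j; rewrite mxE hX //.
by apply: (leq_trans (ltn_ord j)); apply: (leq_trans hk); rewrite leq_addl.
Qed.
Lemma levX_eq0 k X : lev 1 X -> (m < k)%N -> X ^+ k = 0.
Proof. by move=> hX hk; apply: lev_eq0 hk _; apply: levX. Qed.

Lemma nexpE X : nexp X = \sum_(k < m.+1) (k`!%:R^-1 : K) *: X ^+ k.
Proof. by rewrite nexp.unlock. Qed.

Lemma unit_fact k : k`!%:R \is a @GRing.unit K.
Proof. by have := fact_gt0 k; case: (k`!). Qed.

(** Powers beyond [m] vanish, so the series may be cut at any later index; the freedom in [N] allows
    shifted sums of one common length. *)
Lemma nexpM_trunc N c X : (m < N)%N -> lev 1 X ->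
  c * nexp X = \sum_(k < N) (k`!%:R^-1 : K) *: (c * X ^+ k).
Proof.
move=> hN hX.
rewrite nexpE mulr_sumr; under eq_bigr do rewrite -scalerAr.
rewrite -!(big_mkord xpredT (fun k => (k`!%:R^-1 : K) *: (c * X ^+ k))).
rewrite [RHS](big_cat_nat _ hN) //= [X in _ = _ + X]big_nat_cond.
rewrite [X in _ = _ + X]big1 ?addr0 // => k /andP[/andP[h _] _].
by rewrite levX_eq0 // mulr0 scaler0.
Qed.

(** Since [C(k, l) / k! = 1 / (l! (k - l)!)], shifting the index by [l] recovers the exponential;
    [m + l < N] keeps every nonzero power after the shift. *)
Lemma nexp_shift N l c X : (m + l < N)%N -> lev 1 X ->
  \sum_(k < N) (k`!%:R^-1 : K) *: (c * X ^+ (k - l) *+ 'C(k, l))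
  = (l`!%:R^-1 : K) *: (c * nexp X).
Proof.
move=> hN hX; have [hl -> {hN}] : (m < N - l /\ N = l + (N - l))%N by lia.
move: (N - l)%N hl => {}N hN.
rewrite (nexpM_trunc c hN hX) scaler_sumr big_split_ord /=.
rewrite big1 ?add0r => [|i _]; last by rewrite bin_small // mulr0n scaler0.
apply: eq_bigr => k _; rewrite addKn -scaler_nat !scalerA; congr (_ *: _).
have /(congr1 (fun i => i%:R : K)) := bin_fact (leq_addr k l).
rewrite addKn !natrM => h; apply: (mulrI (unit_fact (l + k))).
rewrite mulrA mulrV ?unit_fact // mul1r -h -!mulrA.
rewrite [k`!%:R * _]mulrCA mulrV ?unit_fact // mulr1 mulrV ?unit_fact //.
by rewrite mulr1.
Qed.

(** This is [exp X * Y = exp(ad X)(Y) * exp X], with [exp(ad X)] cut after its quadratic term. *)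
Lemma nexp_br X Y : lev 1 X -> br X (br X (br X Y)) = 0 ->
  nexp X * Y = (Y + br X Y + 2%:R^-1 *: br X (br X Y)) * nexp X.
Proof.
move=> hX h; have lt3 : (m < m.+3)%N by lia.
rewrite -[nexp X in LHS]mul1r (nexpM_trunc _ lt3) // mulr_suml.
under eq_bigr => k _ do rewrite mul1r -scalerAl expr_br_bin // !scalerDr.
rewrite !big_split /= !nexp_shift ?addn0 ?addn1 ?addn2 //.
rewrite !fact0 !factS !invr1 !scale1r [RHS]mulrDl [X in _ = X + _]mulrDl.
by rewrite -scalerAl.
Qed.
End Level.

(** * Exponential identities from differential equations over polynomials *)

Section Differentiation.
Variables (C : numFieldType) (m : nat).
Local Notation P := {poly C}.
Implicit Types (X Y : 'M[C]_m.+1) (U V : 'M[P]_m.+1).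

Lemma unitC k : k.+1%:R \is a @GRing.unit C.
Proof. by rewrite unitfE pnatr_eq0. Qed.
Lemma unitP k : k.+1%:R \is a @GRing.unit P.
Proof. by rewrite -polyC_natr; apply: rmorph_unit; exact: unitC. Qed.

Definition dmx U : 'M[P]_m.+1 := map_mx (@deriv C) U.
Local Notation cst := (map_mx (@polyC C)).

Lemma dmxD U V : dmx (U + V) = dmx U + dmx V.
Proof. by apply/matrixP => i j; rewrite !mxE derivD. Qed.
Lemma dmx_sum I r (F : I -> 'M[P]_m.+1) :
  dmx (\sum_(i <- r) F i) = \sum_(i <- r) dmx (F i).
Proof.
elim: r => [|a r IH]; first by rewrite !big_nil; apply/matrixP => i j; rewrite !mxE deriv0.
by rewrite !big_cons dmxD IH.
Qed.
Lemma dmxM U V : dmx (U * V) = dmx U * V + U * dmx V.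
Proof.
apply/matrixP => i j; rewrite !mxE raddf_sum -big_split; apply: eq_bigr => k _.
by rewrite [LHS]derivM !mxE.
Qed.
Lemma dmxZ (p : P) U : dmx (p *: U) = p^`() *: U + p *: dmx U.
Proof. by apply/matrixP => i j; rewrite !mxE derivM. Qed.
Lemma dmx_cst X : dmx (cst X) = 0.
Proof. by apply/matrixP => i j; rewrite !mxE derivC. Qed.
Lemma dmx1 : dmx 1 = 0.
Proof. by have := dmx_cst 1%:M; rewrite map_mx1. Qed.
Lemma lev_cst k X : lev k X -> lev k (cst X).
Proof. by move=> h i j hij; rewrite mxE h ?polyC0. Qed.

Lemma deriv_invn k : (k%:R^-1 : P)^`() = 0.
Proof.
case: k => [|k]; first by rewrite invr0 deriv0.
by rewrite -polyC_natr -(rmorphV (@polyC C)) ?unitC // derivC.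
Qed.

(** Coefficient [k + 1] of [Q], times [k + 1], is coefficient [k] of [A * Q], which involves only
    coefficients of [Q] up to [k]. These vanish by induction, and the characteristic is zero. *)
Lemma ode_uniq (A Q : 'M[P]_m.+1) : dmx Q = A * Q ->
  (forall i j, (Q i j).[0] = 0) -> Q = 0.
Proof.
move=> hd h0; suff h k : forall i j, (Q i j)`_k = 0.
  by apply/matrixP => i j; apply/polyP => k; rewrite mxE coef0 h.
elim/ltn_ind: k => -[|k] IH i j; first by rewrite -horner_coef0.
have /matrixP/(_ i j)/polyP/(_ k) := hd; rewrite !mxE coef_deriv coef_sum big1.
  by move/eqP; rewrite mulrn_eq0 /= => /eqP.
move=> l _; rewrite coefM big1 // => a _; rewrite IH ?mulr0 //.
by rewrite ltnS leq_subr.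
Qed.

(** Product rule on [U ^+ k * U]: moving [dmx U] to the left of [U ^+ k] costs iterated brackets,
    and Pascal's rule adds up the binomial coefficients. *)
Lemma dmxX U k : let a1 := br U (dmx U) in let a2 := br U a1 in br U a2 = 0 ->
  dmx (U ^+ k) = dmx U * U ^+ (k - 1) *+ 'C(k, 1) + a1 * U ^+ (k - 2) *+ 'C(k, 2)
    + a2 * U ^+ (k - 3) *+ 'C(k, 3).
Proof.
move=> a1 a2 h.
elim: k => [|k IH]; first by rewrite expr0 dmx1 !mulr0n !addr0.
rewrite exprSr dmxM IH expr_br_bin // -/a1 -/a2; clearbody a2 a1; clear IH h.
rewrite !subSS !binS !mulrnDr.
rewrite !mulrDl !mulrnAl -!mulrA -!exprSr !bin0.
have e l x : x * U ^+ (k - l.+1).+1 *+ 'C(k, l.+1) = x * U ^+ (k - l) *+ 'C(k, l.+1).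
  have [hk|hk] := ltnP l k; last by rewrite bin_small.
  by rewrite -subSn.
by rewrite !e addrACA; congr (_ + _); rewrite addrACA.
Qed.

(** The formula [(exp U)' = ((exp(ad U) - 1) / ad U)(U') * exp U], of which the hypothesis on
    brackets leaves the coefficients [1], [1/2!] and [1/3!]. *)
Lemma dmx_nexp U : lev 1 U ->
  let a1 := br U (dmx U) in let a2 := br U a1 in br U a2 = 0 ->
  dmx (nexp U) = (dmx U + (2%:R^-1 : P) *: a1 + (6%:R^-1 : P) *: a2) * nexp U.
Proof.
move=> hU a1 a2 h; have lt4 : (m < m.+4)%N by lia.
have e : nexp U = \sum_(k < m.+4) (k`!%:R^-1 : P) *: U ^+ k.
  rewrite -[LHS]mul1r (nexpM_trunc _ lt4) //.
  by under eq_bigr do rewrite mul1r.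
rewrite {1}e dmx_sum; under eq_bigr => k _ do
  rewrite dmxZ deriv_invn scale0r add0r dmxX // !scalerDr.
have lt1 : (m.+1 < m.+4)%N by lia.
rewrite !big_split /= !(nexp_shift unitP) ?addn1 ?addn2 ?addn3 //.
rewrite !factS invr1 scale1r [RHS]mulrDl [X in _ = X + _]mulrDl.
by rewrite -!scalerAl.
Qed.

Definition ev (a : C) (U : 'M[P]_m.+1) : 'M[C]_m.+1 := map_mx (horner_eval a) U.

Lemma evM a U V : ev a (U * V) = ev a U * ev a V.
Proof. exact: map_mxM. Qed.
Lemma evD a U V : ev a (U + V) = ev a U + ev a V.
Proof. exact: map_mxD. Qed.
Lemma evZ a p U : ev a (p *: U) = p.[a] *: ev a U.
Proof. exact: map_mxZ. Qed.
Lemma ev_cst a X : ev a (cst X) = X.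
Proof. by apply/matrixP => i j; rewrite !mxE /horner_eval hornerC. Qed.
Lemma ev1 a : ev a 1 = 1.
Proof. exact: map_mx1. Qed.

Lemma map_nexp (K K' : comUnitRingType) (f : {rmorphism K -> K'}) (X : 'M[K]_m.+1) :
  (forall k, k.+1%:R \is a @GRing.unit K) ->
  map_mx f (nexp X) = nexp (map_mx f X).
Proof.
move=> uK; rewrite !nexpE raddf_sum; apply: eq_bigr => k _.
rewrite [LHS]map_mxZ rmorphV ?unit_fact // rmorph_nat; congr (_ *: _).
exact: rmorphXn.
Qed.
Lemma ev_nexp a U : ev a (nexp U) = nexp (ev a U).
Proof. by apply: map_nexp; exact: unitP. Qed.

(** The engine for the identities below: each side is made a polynomial curve in a parameter, and
    the two are compared through one linear equation and one initial value. *)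
Lemma ode_eq (A Q1 Q2 : 'M[P]_m.+1) : dmx Q1 = A * Q1 -> dmx Q2 = A * Q2 ->
  ev 0 Q1 = ev 0 Q2 -> Q1 = Q2.
Proof.
move=> h1 h2 h0; apply/eqP; rewrite -subr_eq0; apply/eqP; apply: (@ode_uniq A).
  by rewrite mulrBr -h1 -h2; apply/matrixP => i j; rewrite !mxE derivB.
move=> i j; have /matrixP/(_ i j) := h0; rewrite !mxE hornerD hornerN.
by rewrite /horner_eval => ->; rewrite subrr.
Qed.

Lemma nexp0 : nexp (0 : 'M[C]_m.+1) = 1.
Proof.
rewrite nexpE big_ord_recl big1 ?addr0 ?fact0 ?invr1 ?scale1r //.
by move=> i _; rewrite expr0n scaler0.
Qed.

Lemma dmx_line X : dmx ('X *: cst X) = cst X.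
Proof. by rewrite dmxZ derivX scale1r dmx_cst scaler0 addr0. Qed.
Lemma ev_line a X : ev a ('X *: cst X) = a *: X.
Proof. by rewrite evZ hornerX ev_cst. Qed.
Lemma lev_line k X : lev k X -> lev k ('X *: cst X).
Proof. by move=> h; apply/levZ/lev_cst. Qed.

Lemma dmx_nexp_comm U : lev 1 U -> br U (dmx U) = 0 ->
  dmx (nexp U) = dmx U * nexp U.
Proof.
by move=> hU h; rewrite dmx_nexp ?h ?br0r // !scaler0 !addr0.
Qed.

Lemma cstM X Y : cst (X * Y) = cst X * cst Y.
Proof. exact: map_mxM. Qed.
Lemma cstD X Y : cst (X + Y) = cst X + cst Y.
Proof. exact: map_mxD. Qed.
Lemma cst_br X Y : cst (br X Y) = br (cst X) (cst Y).
Proof. by rewrite !brE -!cstM; exact: map_mxB. Qed.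
Lemma brZl (K : comUnitRingType) (a : K) (X Y : 'M[K]_m.+1) :
  br (a *: X) Y = a *: br X Y.
Proof. by rewrite !brE -scalerAl -scalerAr -scalerBr. Qed.
Lemma brZr (K : comUnitRingType) (a : K) (X Y : 'M[K]_m.+1) :
  br X (a *: Y) = a *: br X Y.
Proof. by rewrite !brE -scalerAl -scalerAr -scalerBr. Qed.

Lemma br_line X Y : br ('X *: cst X) (cst Y) = 'X *: cst (br X Y).
Proof. by rewrite brZl cst_br. Qed.

Lemma dmx_nexp_line X : lev 1 X ->
  dmx (nexp ('X *: cst X)) = cst X * nexp ('X *: cst X).
Proof.
move=> hX; rewrite dmx_nexp_comm ?dmx_line ?br_line ?brxx //; first exact: lev_line.
by rewrite map_mx0 scaler0.
Qed.

Lemma nexp_comm (K : comUnitRingType) (X Y : 'M[K]_m.+1) :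
  (forall k, k.+1%:R \is a @GRing.unit K) ->
  lev 1 X -> br X Y = 0 -> nexp X * Y = Y * nexp X.
Proof. by move=> uK hX h; rewrite nexp_br ?h ?br0r // scaler0 !addr0. Qed.

(** With [X] and [Y] scaled by the indeterminate, both sides solve [Q' = (X + Y) Q]; evaluation at 1
    gives the claim. *)
Lemma nexpD X Y : lev 1 X -> lev 1 Y -> br X Y = 0 ->
  nexp (X + Y) = nexp X * nexp Y.
Proof.
move=> hX hY h; have hXY := levD hX hY.
suff /(congr1 (ev 1)) : nexp ('X *: cst (X + Y)) = nexp ('X *: cst X) * nexp ('X *: cst Y).
  by rewrite evM !ev_nexp !ev_line !scale1r.
apply: (@ode_eq (cst (X + Y))); first exact: dmx_nexp_line.
  have e : nexp ('X *: cst X) * cst Y = cst Y * nexp ('X *: cst X).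
    apply: nexp_comm; [exact: unitP | exact: lev_line |].
    by rewrite br_line h map_mx0 scaler0.
  rewrite dmxM !dmx_nexp_line // [X in _ + X]mulrA e.
  by rewrite cstD mulrDl !mulrA.
by rewrite evM !ev_nexp !ev_line !scale0r nexp0 mulr1.
Qed.

Lemma nexpNK X : lev 1 X -> nexp X * nexp (- X) = 1.
Proof.
move=> hX; rewrite -nexpD ?subrr ?nexp0 ?brNr ?brxx ?oppr0 //; exact: levN.
Qed.
Lemma nexpKN X : lev 1 X -> nexp (- X) * nexp X = 1.
Proof. by move=> hX; rewrite -{2}[X]opprK nexpNK //; apply: levN. Qed.

Lemma nexpMn X k : lev 1 X -> nexp (X *+ k) = nexp X ^+ k.
Proof.
move=> hX; elim: k => [|k IH]; first by rewrite mulr0n nexp0.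
rewrite mulrS nexpD ?IH -?exprS //; first exact: levMn.
elim: k {IH} => [|k IH]; first by rewrite mulr0n br0r.
by rewrite mulrS brDr brxx add0r.
Qed.

Lemma nexp_Ad X Y : lev 1 X -> br X (br X (br X Y)) = 0 ->
  nexp X * Y * nexp (- X) = Y + br X Y + 2%:R^-1 *: br X (br X Y).
Proof. by move=> hX h; rewrite nexp_br //; [rewrite -mulrA nexpNK ?mulr1|exact: unitC]. Qed.

(** A nonzero difference of entries would have more roots among the naturals than its size
    allows. *)
Lemma ev_inj_nat U V : (forall k : nat, ev k%:R U = ev k%:R V) -> U = V.
Proof.
move=> h; apply/matrixP => i j; apply/eqP; rewrite -subr_eq0; apply/negPn/negP => nz.
pose s := [seq (k%:R : C) | k <- iota 0 (size (U i j - V i j))].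
have /(max_poly_roots nz) : all (root (U i j - V i j)) s.
  apply/allP => _ /mapP[k _ ->]; rewrite rootE hornerD hornerN.
  by have /matrixP/(_ i j) := h k; rewrite !mxE /horner_eval => ->; rewrite subrr.
rewrite map_inj_uniq ?iota_uniq; last by move=> x y /eqP; rewrite eqr_nat => /eqP.
by rewrite size_map size_iota ltnn => /(_ isT).
Qed.

(** Equal exponentials have equal powers, so [exp(tX)] and [exp(tY)] agree at every natural [t],
    hence as polynomials; their derivatives at 0 are [X] and [Y]. *)
Lemma nexp_inj X Y : lev 1 X -> lev 1 Y -> nexp X = nexp Y -> X = Y.
Proof.
move=> hX hY e; have /(congr1 (ev 0 \o dmx)) : nexp ('X *: cst X) = nexp ('X *: cst Y).
  apply: ev_inj_nat => k; rewrite !ev_nexp !ev_line !scaler_nat !nexpMn //.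
  by rewrite e.
by rewrite /= !dmx_nexp_line // !evM !ev_nexp !ev_line !scale0r !nexp0 !mulr1 !ev_cst.
Qed.
End Differentiation.

(** * The logarithm of unipotent matrices *)

HB.lock Definition nlog (C : numFieldType) (m : nat) (A : 'M[C]_m.+1) :
  'M[C]_m.+1 := \sum_(k < m.+1) ((-1) ^+ k / k.+1%:R) *: (A - 1) ^+ k.+1.

Section Differentiation.
Variables (C : numFieldType) (m : nat).
Local Notation P := {poly C}.
Implicit Types (A X Y : 'M[C]_m.+1) (U V : 'M[P]_m.+1).
Local Notation cst := (map_mx (@polyC C)).

Lemma nlogE (A : 'M[C]_m.+1) :
  nlog A = \sum_(k < m.+1) ((-1) ^+ k / k.+1%:R) *: (A - 1) ^+ k.+1.
Proof. by rewrite nlog.unlock. Qed.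

Lemma lev_nlog A : lev 1 (A - 1) -> lev 1 (nlog A).
Proof.
move=> h; rewrite nlogE; elim/big_ind: _ => [|x y|k _]; [exact: lev0|exact: levD|].
by apply/levZ/(@lev_le _ _ 1 k.+1) => //; exact: levX.
Qed.

Lemma evX a U k : ev a (U ^+ k) = ev a U ^+ k.
Proof. by elim: k => [|k IH]; rewrite ?ev1 // !exprS evM IH. Qed.

(** With [V = t (A - 1)] and [L = log(1 + V)], both [exp L] and [1 + V] solve [Q' = U (1 + V)^-1 Q]
    and equal 1 at [t = 0]. *)
Lemma nlogK A : lev 1 (A - 1) -> nexp (nlog A) = A.
Proof.
move=> hA; set U := A - 1 in hA; pose V := 'X *: cst U.
have lV : lev 1 V by exact: lev_line.
have dV : dmx V = cst U by exact: dmx_line.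
have cUV : br V (cst U) = 0 by rewrite br_line brxx map_mx0 scaler0.
have evV a : ev a V = a *: U by exact: ev_line.
clearbody V.
pose L := \sum_(k < m.+1) (((-1) ^+ k / k.+1%:R)%:P : P) *: V ^+ k.+1.
(* [S] is the inverse of [1 + V]: the geometric series is finite because [V] is nilpotent. *)
pose S := \sum_(k < m.+1) (- V) ^+ k.
have SV : S * (1 + V) = 1.
  have := subrX1 (- V) m.+1; rewrite (levX_eq0 (levN lV)) // sub0r -/S => /eqP.
  rewrite -opprD mulNr eqr_opp => /eqP e.
  rewrite [RHS]e [1 + _]addrC mulrDr mulrDl mulr1 mul1r; congr (_ + _).
  have c : GRing.comm V S by apply: commr_sum => k _; apply/commrX/commrN.
  by rewrite c.
have dL : dmx L = cst U * S.
  rewrite dmx_sum mulr_sumr; apply: eq_bigr => k _.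
  rewrite dmxZ derivC scale0r add0r dmxX dV cUV ?br0r //.
  rewrite !mul0r !mul0rn !addr0 subn1 bin1 /= -[(cst U * _) *+ _]scaler_nat scalerA.
  rewrite -polyC_natr -polyCM divfK ?pnatr_eq0 // [(- V) ^+ _]exprNn.
  rewrite -signr_odd -[in RHS]signr_odd.
  by case: odd; rewrite ?expr0 ?expr1 ?polyCN ?scaleN1r ?scale1r ?mulN1r ?mul1r ?mulrN.
have lL : lev 1 L.
  rewrite /L; elim/big_ind: _ => [|y z|k _]; [exact: lev0|exact: levD|].
  by apply/levZ/(@lev_le _ _ 1 k.+1) => //; exact: levX.
have evL : ev 1 L = nlog A.
  rewrite nlogE /ev raddf_sum; apply: eq_bigr => k _.
  by rewrite [LHS]evZ hornerC evX evV scale1r.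
suff /(congr1 (ev 1)) : nexp L = 1 + V.
  by rewrite ev_nexp evL evD ev1 evV scale1r addrC subrK.
have c0 : GRing.comm (cst U) V by apply/eqP; rewrite -subr_eq0 -brE brC cUV oppr0.
have cS : GRing.comm (cst U) S by apply: commr_sum => k _; apply/commrX/commrN.
have cVL : GRing.comm V L.
  apply: commr_sum => k _; rewrite /GRing.comm -scalerAr -scalerAl.
  by congr (_ *: _); apply/commrX/commr_refl.
have cUL : GRing.comm (cst U) L.
  apply: commr_sum => k _; rewrite /GRing.comm -scalerAr -scalerAl.
  by congr (_ *: _); apply: commrX.
have cLS : GRing.comm L S.
  by apply: commr_sum => k _; apply/commrX/commrN/commr_sym.
apply: (@ode_eq C m (cst U * S) (nexp L) (1 + V)).
- rewrite dmx_nexp_comm // dL //.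
  by apply/eqP; rewrite brE subr_eq0; apply/eqP/commrM => //; apply/commr_sym.
- by rewrite dmxD dmx1 add0r dV -mulrA SV mulr1.
- rewrite ev_nexp evD ev1 evV scale0r addr0.
  suff -> : ev 0 L = 0 by rewrite nexp0.
  rewrite /ev raddf_sum big1 // => k _.
  by rewrite [LHS]evZ evX evV scale0r expr0n scaler0.
Qed.

(** Symmetric Baker-Campbell-Hausdorff formula when triple brackets commute with [X] and [D]. Both
    factors [D] are scaled by a parameter [t], and the two sides are shown to solve the same
    equation in [t]. *)
Lemma nexp_sym X D : lev 1 X -> lev 1 D ->
  let p := br X (br X D) in let q := br D (br X D) in
  br X p = 0 -> br D p = 0 -> br X q = 0 -> br D q = 0 ->
  nexp D * nexp X * nexp D
    = nexp (X + 2%:R *: D + 6%:R^-1 *: (br X (br X D) - br D (br D X))).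
Proof.
move=> hX hD p q Xp Dp Xq Dq.
pose t : P := 'X; pose x := cst X; pose d := cst D; pose b := br x d.
pose p' := br x b; pose q' := br d b.
have [xp dp xq dq] : [/\ br x p' = 0, br d p' = 0, br x q' = 0 & br d q' = 0].
  by rewrite /p' /q' /b -!cst_br; split; rewrite ?Xp ?Dp ?Xq ?Dq map_mx0.
(* By Jacobi, whatever commutes with [x] and [d] commutes with [b = [x, d]]. *)
have br_b z : br x z = 0 -> br d z = 0 -> br z b = 0.
  by move=> hx hd; rewrite /b jacobi [br z x]brC [br z d]brC hx hd oppr0 br0l br0r addr0.
have pb := br_b _ xp dp; have qb := br_b _ xq dq.
have br_pq z : br x z = 0 -> br d z = 0 -> br z p' = 0 /\ br z q' = 0.
  move=> hx hd; rewrite /p' /q' (jacobi z x b) (jacobi z d b) (br_b z) // !br0r.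
  by rewrite [br z x]brC [br z d]brC hx hd oppr0 !br0l addr0.
have [pp pq] := br_pq _ xp dp; have [qp qq] := br_pq _ xq dq.
have dx : br d x = - b by rewrite brC.
have [pd qd] : br p' d = 0 /\ br q' d = 0.
  by rewrite ![br _ d]brC dp dq oppr0.
have [dp' dq'] : dmx p' = 0 /\ dmx q' = 0.
  by rewrite /p' /q' /b -!cst_br !dmx_cst.
have [lb lp lq] : [/\ lev 1 b, lev 1 p' & lev 1 q'].
  by rewrite /p' /q' /b -!cst_br; split; apply/lev_cst; do !apply: lev_br1.
have [evp evq] : (forall a, ev a p' = p) /\ (forall a, ev a q' = q).
  by rewrite /p' /q' /b -!cst_br; split=> a; rewrite ev_cst.
have [bxd bxb bdb] : [/\ br x d = b, br x b = p' & br d b = q'] by [].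
clearbody q' p' b.
pose z0 := (xp, xq, dp, dq, pp, pq, qp, qq, pd, qd, brxx d).
pose six : P := 6%:R^-1.
have six6 : 6%:R * six = 1 by rewrite divrr // (unitP C 5).
have half : 2%:R^-1 = 3%:R * six.
  apply: (mulrI (unitP C 1)); rewrite divrr ?(unitP C 1) // mulrA -natrM.
  by rewrite six6.
(* The expected logarithm of [exp(tD) exp(X) exp(tD)]: each term carries the power of [t] given by
   its degree in [D]. *)
pose W := x + (2%:R * t) *: d + (six * t) *: p' + (six * t ^+ 2) *: q'.
have dW : dmx W = 2%:R *: d + six *: p' + (2%:R * six * t) *: q'.
  rewrite !dmxD !dmxZ dp' dq' !dmx_cst !scaler0 !addr0 add0r.
  rewrite !derivM deriv_invn !derivX -polyC_natr derivC.
  rewrite !mul0r !add0r !mulr1; congr (_ + _ + _ *: _).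
  ring.
have a1 : br W (dmx W) = 2%:R *: b.
  rewrite dW !(brDl, brDr, brZl, brZr) !(bxd, z0).
  by rewrite !scaler0 !addr0.
have a2 : br W (br W (dmx W)) = 2%:R *: p' + (4%:R * t) *: q'.
  rewrite a1 !(brDl, brDr, brZl, brZr) !(bxb, bdb, pb, qb) !scaler0 !addr0.
  by apply/matrixP => i j; rewrite !mxE; ring.
have a3 : br W (br W (br W (dmx W))) = 0.
  rewrite a2 !(brDl, brDr, brZl, brZr) !z0.
  by rewrite !scaler0 !addr0.
(* The common logarithmic derivative of the two curves. *)
pose Z := 2%:R *: d + b + 2%:R^-1 *: p' + t *: q'.
have lx : lev 1 x by exact: lev_cst.
have ld : lev 1 d by exact: lev_cst.
have lW : lev 1 W by do !apply: levD => //; apply: levZ.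
have ltd : lev 1 (t *: d) by exact: levZ.
have odeW : dmx (nexp W) = Z * nexp W.
  rewrite dmx_nexp ?a3 // a2 a1 dW; congr (_ * _).
  rewrite half -/six /Z half.
  by apply/matrixP => i j; rewrite !mxE; ring: six6.
pose f := nexp (t *: d); pose g := nexp x.
have df : dmx f = d * f by exact: dmx_nexp_line.
have dg : dmx g = 0 by rewrite /g /x -map_nexp ?dmx_cst //; exact: unitC.
have gd : g * d = (d + b + 2%:R^-1 *: p') * g.
  by rewrite (nexp_br (@unitP C) lx) bxd ?bxb.
have fd : f * (d + b + 2%:R^-1 *: p') = (d + b + 2%:R^-1 *: p' + t *: q') * f.
  have e : br (t *: d) (d + b + 2%:R^-1 *: p') = t *: q'.
    by rewrite brZl !brDr brZr bdb brxx dp scaler0 add0r addr0.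
  have e' : br (t *: d) (t *: q') = 0 by rewrite brZl brZr dq !scaler0.
  by rewrite (nexp_br (@unitP C) ltd) e e' ?br0r // scaler0 addr0.
have odeE : dmx (f * g * f) = Z * (f * g * f).
  have e : f * g * (d * f) = (d + b + 2%:R^-1 *: p' + t *: q') * (f * g * f).
    by rewrite -!mulrA [g * (d * f)]mulrA gd -mulrA [f * (_ * _)]mulrA fd -mulrA.
  rewrite !dmxM df dg mulr0 addr0 e -!mulrA -mulrDl.
  by congr (_ * _); rewrite /Z -[2%:R]/(1 + 1) scalerDl scale1r !addrA.
have e0 : ev 0 (f * g * f) = ev 0 (nexp W).
  rewrite !evM !ev_nexp !evD !evZ !ev_cst evp evq hornerX !hornerM hornerX.
  by rewrite !(mulr0, mul0r) !scale0r nexp0 mul1r mulr1 !addr0.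
have /(congr1 (ev 1)) := ode_eq odeE odeW e0.
rewrite !evM !ev_nexp !evD !evZ !ev_cst evp evq !hornerM hornerX scale1r !mulr1.
have -> : six = (6%:R^-1)%:P by rewrite /six -polyC_natr rmorphV ?(unitC C 5).
rewrite hornerC -polyC_natr hornerC => ->; congr nexp.
rewrite -!addrA -scalerDr; congr (_ + (_ + _ *: (_ + _))).
by rewrite [br D X]brC brNr opprK.
Qed.
End Differentiation.

(** * Triple brackets in a 3-step nilpotent Lie algebra *)

Section AdjointAction.
Variables (C : numFieldType) (m : nat).
Local Notation M := 'M[C]_m.+1.
Implicit Types (Z A : M).

(** The operator [Ad(exp Z)]; the cut after the quadratic term is exact when fourfold brackets
    vanish. *)
Definition exp_ad (Z A : M) : M := A + br Z A + 2%:R^-1 *: br Z (br Z A).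

Lemma exp_ad_linear Z : linear (exp_ad Z).
Proof.
move=> a A B; rewrite /exp_ad !(brDr, brZr).
move: (br Z _) (br Z A) (br Z (br Z _)) (br Z (br Z B)) => b c d e.
by apply/matrixP => i j; rewrite !mxE; ring.
Qed.

(** Every term carries the factor [Z - Z0], so the difference is small relative to [A] when [Z] is
    close to [Z0]. *)
Lemma exp_ad_diff Z Z0 A :
  exp_ad Z A - exp_ad Z0 A = br (Z - Z0) A
     + 2%:R^-1 *: (br (Z - Z0) (br Z A) + br Z0 (br (Z - Z0) A)).
Proof.
rewrite /exp_ad !(brDl, brDr, brNl, brNr).
move: (br Z A) (br Z0 A) (br Z (br Z A)) (br Z0 (br Z A)) (br Z0 (br Z0 A)) => b c d e f.
by apply/matrixP => i j; rewrite !mxE; ring.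
Qed.

Lemma lin_sub2 a (x1 x2 x3 y1 y2 y3 : M) :
  a *: (x3 - (x1 + 2%:R *: x2)) + (y3 - (y1 + 2%:R *: y2))
  = a *: x3 + y3 - (a *: x1 + y1 + 2%:R *: (a *: x2 + y2)).
Proof. by apply/matrixP => i j; rewrite !mxE; ring. Qed.

Lemma sub_shift (a b c d k : M) : a + d + b + c - (a + b + c - k) = k + d.
Proof. by apply/matrixP => i j; rewrite !mxE; ring. Qed.

Variable gv : {vspace M}.
Hypothesis gbr : forall A B, A \in gv -> B \in gv -> br A B \in gv.
Hypothesis g4 : forall a b c d, a \in gv -> b \in gv -> c \in gv -> d \in gv ->
  br a (br b (br c d)) = 0.

(** Jacobi writes a bracket of two brackets through nested fourfold brackets. *)
Lemma br_br0 a b c d : a \in gv -> b \in gv -> c \in gv -> d \in gv ->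
  br (br a b) (br c d) = 0.
Proof.
move=> ha hb hc hd; rewrite jacobi [br (br _ c) d]brC [br (br a b) c]brC.
rewrite [br (br a b) d]brC !brNr g4 // oppr0 g4 // !oppr0 addr0 //.
Qed.

(* the second centre, as seen by triple brackets *)
Definition z2 (r : M) : Prop := r \in gv /\ (forall a b, a \in gv -> b \in gv ->
  br r (br a b) = 0 /\ br a (br r b) = 0).

Lemma z2_br p q : p \in gv -> q \in gv -> z2 (br p q).
Proof.
move=> hp hq; split; first exact: gbr.
by move=> a b ha hb; rewrite br_br0 // [br (br p q) b]brC brNr g4 ?oppr0.
Qed.
Lemma z2_lin a r s : z2 r -> z2 s -> z2 (a *: r + s).
Proof.
move=> [hr zr] [hs zs]; split; first by rewrite rpredD ?rpredZ.
move=> x y hx hy; have [r1 r2] := zr _ _ hx hy; have [s1 s2] := zs _ _ hx hy.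
by rewrite !(brDl, brZl, brDr, brZr) r1 r2 s1 s2 scaler0 addr0.
Qed.
Lemma z2_0 : z2 0.
Proof. by split=> [|a b _ _]; rewrite ?rpred0 // !br0l br0r. Qed.
Lemma z2D r s : z2 r -> z2 s -> z2 (r + s).
Proof. by move=> hr hs; rewrite -[r]scale1r; apply: z2_lin. Qed.
Lemma z2Z a r : z2 r -> z2 (a *: r).
Proof. by move=> hr; rewrite -[_ *: _]addr0; apply: z2_lin => //; exact: z2_0. Qed.
Lemma z2N r : z2 r -> z2 (- r).
Proof. by move=> hr; rewrite -scaleN1r; apply: z2Z. Qed.

(** The predicate [z2] tests the outer and the middle slot; the innermost slot reduces to the middle
    one by antisymmetry. *)
Lemma br3_z2 a b c a' b' c' : a \in gv -> b \in gv -> c \in gv ->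
  z2 (a' - a) -> z2 (b' - b) -> z2 (c' - c) ->
  br a' (br b' c') = br a (br b c).
Proof.
move=> ha hb hc; move: (a' - a) (b' - b) (c' - c) (subrK a a') (subrK b b') (subrK c c').
move=> r s u <- <- <- {a' b' c'} [hr zr] [hs zs] [hu zu].
have hrs : s + b \in gv by rewrite rpredD.
have huc : u + c \in gv by rewrite rpredD.
rewrite (brDl r) (zr _ _ hrs huc).1 add0r (brDl s) brDr (zs _ _ ha huc).2 add0r.
by rewrite (brDr b) brDr [br b u]brC brNr (zu _ _ ha hb).2 oppr0 add0r.
Qed.

Lemma exp_ad_z2 Z A : Z \in gv -> A \in gv -> z2 (exp_ad Z A - A).
Proof.
move=> hZ hA; rewrite /exp_ad -[X in X - A]addrA addrAC subrr add0r.
by apply/z2D/z2Z; apply: z2_br => //; exact: gbr.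
Qed.

(** All the corrections to [X + 2D] are brackets, and brackets lie in the second centre. *)
Lemma bch_z2 W X D : W \in gv -> X \in gv -> D \in gv ->
  z2 (exp_ad W X + 2%:R *: D + 6%:R^-1 *: (br X (br X D) - br D (br D X))
      - (X + 2%:R *: D)).
Proof.
move=> hW hX hD; have := exp_ad_z2 hW hX; move: (exp_ad W X) => X' zX.
have -> : X' + 2%:R *: D + 6%:R^-1 *: (br X (br X D) - br D (br D X)) - (X + 2%:R *: D)
     = (X' - X) + 6%:R^-1 *: (br X (br X D) + - br D (br D X)).
  move: (2%:R *: D) (6%:R^-1 *: _) => d e.
  by apply/matrixP => i j; rewrite !mxE; ring.
apply/z2D/z2Z/z2D => //; [|apply: z2N]; apply: z2_br => //; exact: gbr.
Qed.

(** The right-hand side involves only [W], [L] and [D], so it stays bounded with them. Modulo the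
    second centre [eta] agrees with [xi] and [YL] with [L + 2D], so the triple brackets in [ch]
    expand in [xi], [L] and [D]; those without [D] cancel against [cv]. *)
Lemma key_identity W xi L D Y YL :
  W \in gv -> xi \in gv -> L \in gv -> D \in gv ->
  z2 (YL - (L + 2%:R *: D)) ->
  let X := xi + L in let eta := Y - YL in
  Y = exp_ad W X + 2%:R *: D + 6%:R^-1 *: (br X (br X D) - br D (br D X)) ->
  let cv := - 6%:R^-1 *: (2%:R^-1 *: br xi (br xi L) + 4%:R^-1 *: br L (br xi L)) in
  let ch := 6%:R^-1 *: (2%:R^-1 *: br eta (br eta YL) + 4%:R^-1 *: br YL (br eta YL)) in
  Y - ch - exp_ad (W - 4%:R^-1 *: br L D) (xi + cv) =
    exp_ad W L + 2%:R *: D + 6%:R^-1 *: (br L (br L D) - br D (br D L)).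
Proof.
move=> hW hx hL hD zYL X eta hY cv ch.
have hX : X \in gv by rewrite rpredD.
have zeta : z2 (eta - xi).
  have -> : eta - xi = (Y - (X + 2%:R *: D)) + - (YL - (L + 2%:R *: D)).
    rewrite /eta /X; move: (2%:R *: D) => d.
    by apply/matrixP => i j; rewrite !mxE; ring.
  apply: z2D; last exact: z2N.
  by rewrite hY; exact: bch_z2.
have hLD : L + 2%:R *: D \in gv by rewrite rpredD // rpredZ.
have e1 : br eta (br eta YL) = br xi (br xi (L + 2%:R *: D)) by apply: br3_z2.
have e2 : br YL (br eta YL) = br (L + 2%:R *: D) (br xi (L + 2%:R *: D)).
  by apply: br3_z2.
have br_cv Z : Z \in gv -> br Z cv = 0.
  by move=> hZ; rewrite /cv brZr brDr !brZr !g4 // !scaler0 addr0 scaler0.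
have hZ : W - 4%:R^-1 *: br L D \in gv by rewrite rpredB // rpredZ // gbr.
have eZ : exp_ad (W - 4%:R^-1 *: br L D) (xi + cv) =
    xi + cv + (br W xi - 4%:R^-1 *: br (br L D) xi) + 2%:R^-1 *: br W (br W xi).
  have uLD : br L D \in gv by exact: gbr.
  have b1 : br (W - 4%:R^-1 *: br L D) (xi + cv) = br W xi - 4%:R^-1 *: br (br L D) xi.
    by rewrite brDr br_cv // addr0 brDl brNl brZl.
  have b2 : br W (br (br L D) xi) = 0 by rewrite [br (br L D) xi]brC brNr g4 ?oppr0.
  have b3 : br (br L D) (br W xi) = 0 by exact: br_br0.
  have b4 : br (br L D) (br (br L D) xi) = 0 by exact: br_br0.
  have b5 : br (W - 4%:R^-1 *: br L D) (br W xi - 4%:R^-1 *: br (br L D) xi)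
    = br W (br W xi).
    rewrite brDl !brDr !brNl !brNr !brZl !brZr b2 b3 b4.
    by rewrite !(scaler0, subr0, oppr0, addr0).
  by rewrite /exp_ad b1 b5.
rewrite eZ hY /ch e1 e2 /cv /X /exp_ad !(brDl, brDr, brNl, brNr, brZl, brZr).
(* With this form of Jacobi the remaining triple brackets in [xi] add up to [3/2 [xi, [L, D]]].
   Times [1/6] this is [1/4 [xi, [L, D]]], exactly what the shift of [W] by [- 1/4 [L, D]]
   produces. *)
have j1 : br D (br xi L) = br L (br xi D) - br xi (br L D).
  by rewrite (jacobi xi L D) [br (br xi L) D]brC opprD opprK addrCA subrr addr0.
rewrite j1 [br (br L D) xi]brC [br D xi]brC [br D L]brC !brNr.
move: (br xi (br xi D)) (br xi (br L D)) (br L (br xi D)) (br L (br L D)) => a1 a2 a3 a4.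
move: (br D (br xi D)) (br D (br L D)) (br xi (br xi L)) (br L (br xi L)) => b1 b2 b3 b4.
move: (br W (br W xi)) (br W (br W L)) (br W xi) (br W L) => c1 c2 c3 c4.
by apply/matrixP => i j; rewrite !mxE; field.
Qed.

End AdjointAction.

(** * The Lie algebra of an algebraic subgroup *)

Section Group.
Variables (R : realType) (m : nat).
Local Notation C := R[i].
Local Notation M := 'M[C]_m.+1.
Local Notation P := {poly C}.
Implicit Types (X Y A : M) (G H : set M).
Local Notation cst := (map_mx (@polyC C)).

(** A defining polynomial pulled back along the curve has infinitely many roots, hence is zero.
    Testing only positive integers lets [log_setD] divide by the parameter. *)
Lemma algebraic_set_poly (Z : set M) (U : 'M[P]_m.+1) : algebraic_set Z ->
  (forall k : nat, Z (ev k.+1%:R U)) -> forall a, Z (ev a U).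
Proof.
move=> [S ->] h a p Sp; pose q : P := \sum_(n <- mpoly.msupp p)
   (mpoly.mcoeff n p)%:P * \prod_i mxvec U 0 i ^+ mpoly.fun_of_multinom n i.
have qE b : q.[b] = mpoly.meval (fun k => mxvec (ev b U) 0 k) p.
  rewrite mpoly.mevalE horner_sum; apply: eq_bigr => n _.
  rewrite hornerM hornerC horner_prod; congr (_ * _); apply: eq_bigr => i _.
  by rewrite horner_exp -map_mxvec mxE.
rewrite -qE; apply/eqP/negPn/negP => nz.
have q0 : q != 0 by apply: contraNneq nz => ->; rewrite horner0.
pose s := [seq (k.+1%:R : C) | k <- iota 0 (size q)].
have /(max_poly_roots q0) : all (root q) s.
  by apply/allP => _ /mapP[k _ ->]; rewrite rootE qE h.
rewrite map_inj_uniq ?iota_uniq; last by move=> x y /eqP; rewrite eqr_nat => /eqP[].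
by rewrite size_map size_iota ltnn => /(_ isT).
Qed.

(** An algebraic counterpart of [lie_algebra]: [nexp] is a polynomial map, so no limit
    intervenes. *)
Definition log_set H : set M := [set X | lev 1 X /\ H (nexp X)].

Section Unipotent.
Variables (G H : set M).
Hypotheses (hG : unipotent_lie_group G) (hH : algebraic_subgroup H G).

Lemma unipotent_lev A : H A -> lev 1 (A - 1).
Proof.
case: hG => sG _ _ _ _; case: hH => sH _ _ _ _ /sH/sG hA i j.
rewrite addn1 ltnS => hij; have := hA i j hij; rewrite !mxE => ->.
by rewrite subrr.
Qed.

Lemma subgroupX A k : H A -> H (A ^+ k).
Proof.
case: hH => _ _ H1 HM _ hA; elim: k => [//|k IH]; rewrite exprS; exact: HM.
Qed.

(** The curve [exp(tX)] is polynomial in [t], and its values at positive integers are powers of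
    [exp X]. *)
Lemma log_setZ a X : log_set H X -> log_set H (a *: X).
Proof.
move=> [lX HX]; split; first exact: levZ.
rewrite -ev_line -ev_nexp; case: hH => _ algH _ _ _.
apply: algebraic_set_poly => // k; rewrite ev_nexp ev_line scaler_nat nexpMn //.
exact: subgroupX.
Qed.

Lemma log_set_nlog A : H A -> log_set H (nlog A).
Proof.
move=> hA; have l := unipotent_lev hA; split; first exact: lev_nlog.
by rewrite nlogK.
Qed.

Lemma nexp_conj A B X : A * B = 1 -> B * A = 1 -> nexp (A * X * B) = A * nexp X * B.
Proof.
move=> AB BA; rewrite !nexpE mulr_sumr mulr_suml; apply: eq_bigr => k _.
rewrite -scalerAr -scalerAl; congr (_ *: _).
elim: (nat_of_ord k) => [|n IH]; first by rewrite !expr0 mulr1 AB.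
by rewrite exprS IH !exprS -!mulrA (mulrA B) BA mul1r.
Qed.

End Unipotent.

(** The partial sums are constant once their length exceeds [m]. *)
Lemma mexp_nexp X : lev 1 X -> mexp X = nexp X.
Proof.
move=> lX; apply: lim_near_cst; first exact: norm_hausdorff.
exists m.+1 => // N /= hN; rewrite /series /= big_mkord.
rewrite -[RHS]mul1r (nexpM_trunc _ hN) //.
by apply: eq_bigr => k _; rewrite mul1r.
Qed.

Definition nil4 (g : set M) := forall a b c d, g a -> g b -> g c -> g d ->
  br a (br b (br c d)) = 0.

Lemma log_set_lie G X : unipotent_lie_group G -> algebraic_subgroup G G ->
  log_set G X -> lie_algebra G X.
Proof.
move=> hG hGG lX t; have [lt Gt] := log_setZ hGG t lX.
by rewrite mexp_nexp.
Qed.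

Lemma unipotent_subgroup G : unipotent_lie_group G -> algebraic_subgroup G G.
Proof. by case=> _ ? ? ? ?; split. Qed.

(** A fourfold bracket lies in the term of index 3 of the descending central series. *)
Lemma nil4_log_set G : unipotent_lie_group G -> 
  step_nilpotent 3 (lie_algebra G) -> nil4 (log_set G).
Proof.
move=> hG [h3 _] a b c d ha hb hc hd.
have hGG := unipotent_subgroup hG.
have sp (S : set M) Z : S Z -> linear_span S Z.
  move=> SZ; exists [:: Z]; last by apply: memv_span; rewrite inE.
  by move=> y /=; rewrite inE => /eqP ->.
have lie X : log_set G X -> lie_algebra G X by exact: log_set_lie.
have dcs k X Y : log_set G X -> descending_central_series (lie_algebra G) k Y ->
    descending_central_series (lie_algebra G) k.+1 (br X Y).
  by move=> hX hY; apply: sp; exists X, Y; split; [exact: lie | | rewrite brE].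
suff : descending_central_series (lie_algebra G) 3 (br a (br b (br c d))) by rewrite h3.
by do 3 (apply: (dcs) => //); exact: lie.
Qed.

Section LieAlgebra.
Variables (G H : set M).
Hypotheses (hG : unipotent_lie_group G) (hH : algebraic_subgroup H G).
Hypothesis g4 : nil4 (log_set G).

Lemma log_set_sub X : log_set H X -> log_set G X.
Proof. by case: hH => sH _ _ _ _ [lX /sH]. Qed.

Lemma log_setN X : log_set H X -> log_set H (- X).
Proof. by rewrite -scaleN1r; apply: (log_setZ hH). Qed.

Lemma log_set_conj X Y : log_set H X -> log_set H Y ->
  log_set H (Y + br X Y + 2%:R^-1 *: br X (br X Y)).
Proof.
move=> hX hY; have [lX HX] := hX; have [lY HY] := hY.
split.
  by do !apply: levD => //; do ?apply: levZ; do !apply: lev_br1.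
have b3 : br X (br X (br X Y)) = 0 by apply: g4; exact: log_set_sub.
rewrite -(nexp_Ad lX b3).
have [_ HX'] := log_setN hX.
rewrite (nexp_conj _ (nexpNK lX) (nexpKN lX)).
case: hH => _ _ _ HM _; exact: (HM _ _ (HM _ _ HX HY) HX').
Qed.

(** With [Y = 2D], the product [exp(sD) exp(sX) exp(sD)] equals [exp(s (X + Y + s^2 Q))]. Rescaling
    by [1/s] puts the polynomial curve [exp(X + Y + s^2 Q)] in [H] for positive integers [s], hence
    also at [s = 0]. *)
Lemma log_setD X Y : log_set H X -> log_set H Y -> log_set H (X + Y).
Proof.
move=> hX hY; pose D := 2%:R^-1 *: Y.
have hD : log_set H D by exact: (log_setZ hH).
have Y2 : Y = 2%:R *: D by rewrite scalerA divff ?pnatr_eq0 // scale1r.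
clearbody D.
have [gX gD] := (log_set_sub hX, log_set_sub hD).
have [[lX HX] [lD _]] := (hX, hD).
pose Q := 6%:R^-1 *: (br X (br X D) - br D (br D X)).
have lQ : lev 1 Q by apply: levZ; apply: levB; do !apply: lev_br1.
pose U := nexp (cst (X + Y) + 'X^2 *: cst Q).
have evU a : ev a U = nexp (X + Y + a ^+ 2 *: Q).
  by rewrite ev_nexp evD evZ !ev_cst hornerXn.
split; first by apply: levD; rewrite // Y2; apply: levZ.
suff /(_ 0) : forall a, H (ev a U) by rewrite evU expr0n scale0r addr0.
case: (hH) => _ algH _ HM _.
apply: algebraic_set_poly => // k; rewrite evU.
have nz : (k.+1%:R : C) != 0 by rewrite pnatr_eq0.
move: (k.+1%:R : C) nz => s nz.
suff [] : log_set H (s *: (X + Y + s ^+ 2 *: Q)).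
  move=> lZ HZ; have [_] := log_setZ hH s^-1 (conj lZ HZ).
  by rewrite scalerA mulVf // scale1r.
split.
  by apply: levZ; apply: levD; [apply: levD; rewrite // Y2|]; apply: levZ.
have [lsX HsX] := log_setZ hH s hX; have [lsD HsD] := log_setZ hH s hD.
have [gsX gsD] := (log_set_sub (conj lsX HsX), log_set_sub (conj lsD HsD)).
have e := nexp_sym lsX lsD (g4 gsX gsX gsX gsD) (g4 gsD gsX gsX gsD)
  (g4 gsX gsD gsX gsD) (g4 gsD gsD gsX gsD).
rewrite !(brZl, brZr) in e.
suff -> : s *: (X + Y + s ^+ 2 *: Q) = s *: X + 2%:R *: (s *: D) +
   6%:R^-1 *: (s *: (s *: (s *: br X (br X D))) - s *: (s *: (s *: br D (br D X)))).
  by rewrite -e; exact: (HM _ _ (HM _ _ HsD HsX) HsD).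
rewrite Y2 /Q; move: (br X _) (br D _) => u v.
by apply/matrixP => i j; rewrite !mxE; ring.
Qed.

(** The bracket is half the difference of [Ad(exp X) Y] and [Ad(exp(-X)) Y]: the terms even in [X]
    cancel. *)
Lemma log_set_br X Y : log_set H X -> log_set H Y -> log_set H (br X Y).
Proof.
move=> hX hY; have h1 := log_set_conj hX hY.
have h2 := log_setN (log_set_conj (log_setN hX) hY).
have := log_setZ hH 2%:R^-1 (log_setD h1 h2).
congr (log_set H _); rewrite !(brNl, brNr) opprK.
move: (br X (br X Y)) (br X Y) => u v.
by apply/matrixP => i j; rewrite !mxE; field.
Qed.

Lemma log_set0 : log_set H 0.
Proof. by split; [exact: lev0 | rewrite nexp0; case: hH]. Qed.
End LieAlgebra.
End Group.

(** A subspace of maximal dimension inside [S] is all of [S], since adding to it the line through a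
    point of [S] stays inside [S]. *)
Lemma vspace_of_set (K : fieldType) (vT : vectType K) (S : set vT) :
  S 0 -> (forall a x y, S x -> S y -> S (a *: x + y)) ->
  exists U : {vspace vT}, forall x, x \in U <-> S x.
Proof.
move=> S0 SD.
suff [U [sU mU]] : exists U : {vspace vT}, (forall x, x \in U -> S x) /\
    forall W : {vspace vT}, (forall x, x \in W -> S x) -> (\dim W <= \dim U)%N.
  exists U => x; split=> [/sU //|Sx].
  have h : forall y, y \in (<[x]> + U)%VS -> S y.
    by move=> _ /memv_addP[_ /vlineP[a ->] [z zU ->]]; apply/SD/sU.
  have /eqP -> : U == (<[x]> + U)%VS by rewrite eqEdim addvSr mU.
  by apply: subvP (addvSl _ _) _ (memv_line _).
pose Q k := exists U : {vspace vT}, (forall x, x \in U -> S x) /\ (k <= \dim U)%N.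
have Q0 : exists k, `[< Q k >].
  by exists 0%N; apply/asboolP; exists 0%VS; split => // x; rewrite memv0 => /eqP ->.
have Qb k : `[< Q k >] -> (k <= \dim {:vT})%N.
  by move/asboolP=> [U [_ h]]; apply: (leq_trans h); apply/dimvS/subvf.
case: (ex_maxnP Q0 Qb) => k /asboolP[U [sU kU]] kmax.
exists U; split=> // W sW; apply: leq_trans kU; apply: kmax.
by apply/asboolP; exists W.
Qed.

(** * Boundedness and limits along an ultrafilter *)

Lemma hom_of_linear (K : fieldType) (vT wT : vectType K) (f : vT -> wT) :
  linear f -> exists g : 'Hom(vT, wT), forall x, g x = f x.
Proof.
move=> lf; pose F : {linear vT -> wT} :=
  HB.pack f (GRing.isLinear.Build K vT wT *:%R f lf).
by exists (linfun F) => x; rewrite lfunE.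
Qed.

(** The map [g] comes from a pseudo-inverse of [f] composed with the projection to [U]. It makes
    choices of preimages linear, hence bounded. *)
Lemma linear_section (K : fieldType) (vT wT : vectType K) (f : 'Hom(vT, wT))
    (U : {vspace vT}) :
  exists g : 'Hom(wT, vT), forall u, u \in U -> g (f u) \in U /\ f (g (f u)) = f u.
Proof.
pose h := (f \o projv U)%VF; exists (projv U \o h^-1)%VF => u uU.
rewrite comp_lfunE memv_proj; split=> //.
have e : f u = h u by rewrite comp_lfunE projv_id.
rewrite {2}e -[in RHS](@limg_lfunVK _ _ _ h (h u)) ?memv_img ?memvf //.
by rewrite [RHS]comp_lfunE e.
Qed.

Section Norm.
Variables (C : numFieldType) (m : nat).
Local Notation M := 'M[C]_m.+1.
Implicit Types A B : M.

(** The sum norm is submultiplicative, which gives the bounds on products and brackets. *)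
Definition nrm A : C := \sum_i \sum_j `|A i j|.

Lemma nrm_ge0 A : 0 <= nrm A.
Proof. by do !apply: sumr_ge0 => ? _. Qed.
Lemma nrmD A B : nrm (A + B) <= nrm A + nrm B.
Proof.
rewrite /nrm -big_split; apply: ler_sum => i _; rewrite -big_split /=.
by apply: ler_sum => j _; rewrite mxE ler_normD.
Qed.
Lemma nrmZ a A : nrm (a *: A) = `|a| * nrm A.
Proof.
rewrite /nrm mulr_sumr; apply: eq_bigr => i _; rewrite mulr_sumr.
by apply: eq_bigr => j _; rewrite mxE normrM.
Qed.
Lemma nrmN A : nrm (- A) = nrm A.
Proof. by rewrite -scaleN1r nrmZ normrN1 mul1r. Qed.
Lemma nrmB A B : nrm (A - B) <= nrm A + nrm B.
Proof. by rewrite -(nrmN B) nrmD. Qed.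
Lemma nrm0 : nrm 0 = 0.
Proof. by rewrite -(scale0r (0 : M)) nrmZ normr0 mul0r. Qed.
Lemma nrm_entry A i j : `|A i j| <= nrm A.
Proof.
rewrite /nrm (bigD1 i) //= (bigD1 j) //= -addrA lerDl.
by apply: addr_ge0; do ?apply: sumr_ge0 => ? _; do ?apply: sumr_ge0.
Qed.
Lemma nrm_eq0 A : nrm A = 0 -> A = 0.
Proof.
move=> h; apply/matrixP => i j; rewrite mxE; apply/eqP; rewrite -normr_le0.
by rewrite -h nrm_entry.
Qed.
Lemma nrmM A B : nrm (A * B) <= nrm A * nrm B.
Proof.
rewrite /nrm mulr_suml; apply: ler_sum => i _; rewrite mulr_suml.
apply: (@le_trans _ _ (\sum_j \sum_k `|A i k| * `|B k j|)).
  apply: ler_sum => j _; rewrite mxE; apply: le_trans (ler_norm_sum _ _ _) _.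
  by apply: ler_sum => k _; rewrite normrM.
rewrite exchange_big; apply: ler_sum => k _; rewrite -mulr_sumr.
apply: ler_wpM2l => //; rewrite [leRHS](bigD1 k) //= lerDl.
by do !apply: sumr_ge0 => ? _.
Qed.
Lemma nrm_br A B : nrm (br A B) <= 2%:R * nrm A * nrm B.
Proof.
rewrite brE; apply: le_trans (nrmB _ _) _.
rewrite -[2%:R]/(1 + 1) !mulrDl mul1r; apply: lerD; first exact: nrmM.
by rewrite mulrC nrmM.
Qed.

(** Expansion in elementary matrices: the constant is the sum of the norms of their images. *)
Lemma linear_bound (f : M -> M) : linear f ->
  exists2 c, 0 <= c & forall A, nrm (f A) <= c * nrm A.
Proof.
move=> lf; have f0 : f 0 = 0 
  by have /(congr1 (fun x => x - f 0)) := lf 1 0 0; rewrite !scale1r addr0 addrK subrr.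
exists (\sum_i \sum_j nrm (f (delta_mx i j))).
  by do !apply: sumr_ge0 => ? _.
move=> A; have fD x y : f (x + y) = f x + f y by have := lf 1 x y; rewrite !scale1r.
have fZ a x : f (a *: x) = a *: f x by have := lf a x 0; rewrite f0 !addr0.
have nsum (I : finType) (g : I -> M) : nrm (\sum_i g i) <= \sum_i nrm (g i).
  by elim/big_ind2: _ => [|x a y b h1 h2|//]; rewrite ?nrm0 // (le_trans (nrmD _ _)) ?lerD.
have fsum (I : finType) (g : I -> M) : f (\sum_i g i) = \sum_i f (g i).
  exact: (big_morph _ fD f0).
rewrite {1}(matrix_sum_delta A) fsum mulr_suml; apply: le_trans (nsum _ _) _.
apply: ler_sum => i _; rewrite fsum mulr_suml; apply: le_trans (nsum _ _) _.
apply: ler_sum => j _; rewrite fZ nrmZ mulrC.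
by apply: ler_wpM2l; [exact: nrm_ge0 | exact: nrm_entry].
Qed.

Section Bounded.
Variables (T : Type) (F : set_system T).
Hypothesis FF : Filter F.
Implicit Types f g : T -> M.

Definition bnd f := exists K : C, F [set t | nrm (f t) <= K].

Lemma bnd_le f (g : T -> M) (c : C) (S : set T) : F S -> 0 <= c -> bnd f ->
  (forall t, S t -> nrm (g t) <= c * nrm (f t)) -> bnd g.
Proof.
move=> FS c0 [K FK] h; exists (c * K); apply: filterS (filterI FS FK) => t [St hK].
by apply: le_trans (h _ St) _; apply: ler_wpM2l.
Qed.
Lemma bnd_eq f g (S : set T) : F S -> (forall t, S t -> f t = g t) -> bnd f -> bnd g.
Proof.
by move=> FS h hf; apply: (bnd_le FS ler01 hf) => t St; rewrite mul1r h.
Qed.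
Lemma bnd_cst A : bnd (fun=> A).
Proof. by exists (nrm A); apply: filterS filterT => t _ /=. Qed.
Lemma bndD f g : bnd f -> bnd g -> bnd (fun t => f t + g t).
Proof.
move=> [K FK] [L FL]; exists (K + L); apply: filterS (filterI FK FL) => t [h1 h2].
by apply: le_trans (nrmD _ _) _; apply: lerD.
Qed.
Lemma bndZ a f : bnd f -> bnd (fun t => a *: f t).
Proof.
move=> hf; apply: (@bnd_le f _ `|a| setT) => //; first exact: filterT.
by move=> t _; rewrite nrmZ.
Qed.
Lemma bndN f : bnd f -> bnd (fun t => - f t).
Proof.
by move=> [K h]; exists K; apply: filterS h => t /=; rewrite nrmN.
Qed.
Lemma bndB f g : bnd f -> bnd g -> bnd (fun t => f t - g t).
Proof. by move=> hf hg; apply/bndD/bndN. Qed.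
Lemma bndM f g : bnd f -> bnd g -> bnd (fun t => f t * g t).
Proof.
move=> [K FK] [L FL]; exists (K * L); apply: filterS (filterI FK FL) => t [h1 h2].
by apply: le_trans (nrmM _ _) _; apply: ler_pM => //; exact: nrm_ge0.
Qed.
Lemma bndX k f : bnd f -> bnd (fun t => f t ^+ k).
Proof.
move=> hf; elim: k => [|k IH]; first exact: bnd_cst.
by under eq_fun do rewrite exprS; apply: bndM.
Qed.
Lemma bnd_br f g : bnd f -> bnd g -> bnd (fun t => br (f t) (g t)).
Proof.
by move=> hf hg; under eq_fun do rewrite brE; apply: bndB; apply: bndM.
Qed.
Lemma bnd_sum n (f : 'I_n -> T -> M) : (forall i, bnd (f i)) ->
  bnd (fun t => \sum_(i < n) f i t).
Proof.
elim: n f => [|n IH] f h.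
  by under eq_fun do rewrite big_ord0; exact: bnd_cst.
by under eq_fun do rewrite big_ord_recl; apply: bndD => //; apply: IH.
Qed.
Lemma bnd_linear (h : M -> M) f : linear h -> bnd f -> bnd (fun t => h (f t)).
Proof.
move=> /linear_bound[c c0 hc] hf.
by apply: (@bnd_le f _ c setT) => //; first exact: filterT.
Qed.
Lemma bnd_nexp f : bnd f -> bnd (fun t => nexp (f t)).
Proof. by move=> hf; under eq_fun do rewrite nexpE; apply: bnd_sum => i; apply/bndZ/bndX. Qed.
Lemma bnd_nlog f : bnd f -> bnd (fun t => nlog (f t)).
Proof.
move=> hf; under eq_fun do rewrite nlogE.
by apply: bnd_sum => i; apply/bndZ/bndX/bndB => //; exact: bnd_cst.
Qed.
End Bounded.
End Norm.

Lemma ultra_fmap (T U : Type) (f : T -> U) (F : set_system T) :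
  UltraFilter F -> UltraFilter (f @ F).
Proof.
move=> FU; split; first exact: fmap_proper_filter.
move=> G GP sFG; apply/seteqP; split => // A GA.
have [//|FA] := @in_ultra_setVsetC _ F (f @^-1` A) FU.
have /filter_ex[x []] : G (A `&` ~` A) by apply: filterI => //; exact: sFG.
by [].
Qed.

Section Limits.
Variables (R : realType) (m : nat).
Local Notation C := R[i].
Local Notation M := 'M[C]_m.+1.
Variables (T : Type) (F : set_system T).
Implicit Types (A B : M) (f : T -> M).

Lemma norm_complex_le (x : C) : `|x| <= `|complex.Re x|%:C + `|complex.Im x|%:C.
Proof.
rewrite {1}[x]complexE; apply: le_trans (ler_normD _ _) _.
rewrite normrM !normc_def /= !expr0n /= expr1n !addr0 add0r sqrtr1 mul1r.
by rewrite !sqrtr_sqr.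
Qed.

Lemma ultra_lim_real (u : T -> R) (K : R) : UltraFilter F ->
  F [set t | `|u t| <= K] -> exists a, forall e, 0 < e -> F [set t | `|u t - a| < e].
Proof.
move=> FU FK; have uU := ultra_fmap u FU.
have := @segment_compact R (- K) K; rewrite compact_ultra => /(_ _ uU) [].
  suff : F (u @^-1` `[- K, K]) by [].
  by apply: filterS FK => t h; rewrite /= in_itv /= -ler_norml.
move=> a [_ ua]; exists a => e e0.
have hb : F (u @^-1` (ball a e)) by apply: ua; exact: nbhsx_ballx.
by apply: filterS hb => t h /=; rewrite distrC; exact: h.
Qed.

(** Real and imaginary parts converge separately. Their bound is the real part of [K], since [K] is
    itself a complex number. *)
Lemma ultra_lim_complex (u : T -> C) (K : C) : UltraFilter F ->
  F [set t | `|u t| <= K] -> exists a, forall e, 0 < e -> F [set t | `|u t - a| < e].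
Proof.
move=> FU FK.
have le_re (x : C) : `|complex.Re x|%:C <= `|x| by exact: normc_ge_Re.
have le_im (x : C) : `|complex.Im x|%:C <= `|x|.
  by rewrite normc_def lecR -sqrtr_sqr ler_sqrt ?lerDr ?sqr_ge0 // addr_ge0 ?sqr_ge0.
have conv (x : C) (y : R) : y%:C <= `|x| -> `|x| <= K -> y <= complex.Re K.
  by move=> h1 h2; have := le_trans h1 h2; rewrite lecE => /andP[].
have [|a ha] := @ultra_lim_real (fun t => complex.Re (u t)) (complex.Re K) FU.
  by apply: filterS FK => t /=; apply: conv.
have [|b hb] := @ultra_lim_real (fun t => complex.Im (u t)) (complex.Re K) FU.
  by apply: filterS FK => t /=; apply: conv.
exists (a +i* b) => e e0; have [e1 e2] : e = (complex.Re e)%:C /\ 0 < complex.Re e / 2.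
  move: e0; case: e => x y; rewrite ltcE /=. move=> /andP[/eqP -> h].
  by split=> //; rewrite divr_gt0.
apply: filterS (filterI (ha _ e2) (hb _ e2)) => t [h1 h2].
apply: le_lt_trans (norm_complex_le _) _; rewrite e1.
rewrite -rmorphD ltcR [ltRHS]splitr.
have eR : complex.Re (u t - a +i* b) = complex.Re (u t) - a by case: (u t).
have eI : complex.Im (u t - a +i* b) = complex.Im (u t) - b by case: (u t).
by rewrite eR eI; apply: ltrD.
Qed.

Lemma cvg_nrmP f A : Filter F ->
  (f @ F --> A) <-> forall e, 0 < e -> F [set t | nrm (f t - A) < e].
Proof.
move=> FF; split=> [/cvg_ballP h e e0|h].
  (* Each of the [(m + 1)^2] entries gets the tolerance [e / (2 (m + 1)^2)]; the factor 2 makes the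
     final inequality strict. *)
  have N0 : 0 < (m.+1 * m.+1)%:R * 2%:R :> C by rewrite -natrM ltr0n.
  apply: filterS (h (e / ((m.+1 * m.+1)%:R * 2%:R)) (divr_gt0 e0 N0)) => t [_ hb] /=.
  apply: (@le_lt_trans _ _ (e / 2%:R)); last first.
    by rewrite ltr_pdivrMr // ltr_pMr // ltr1n.
  apply: (@le_trans _ _ (\sum_(i < m.+1) \sum_(j < m.+1) (e / ((m.+1 * m.+1)%:R * 2%:R)))).
    apply: ler_sum => i _; apply: ler_sum => j _; rewrite !mxE distrC.
    exact: (ltW (hb i j)).
  rewrite !sumr_const !card_ord -mulrnA -mulr_natl.
  rewrite le_eqVlt; apply/orP; left; apply/eqP; field.
  by rewrite nat1r pnatr_eq0.
apply/cvg_ballP => e e0; apply: filterS (h e e0) => t /= ht; split=> // i j.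
rewrite /ball /= distrC; apply: le_lt_trans ht.
by have := nrm_entry (f t - A) i j; rewrite !mxE.
Qed.

Lemma cvg_bnd f A : Filter F -> f @ F --> A -> bnd F f.
Proof.
move=> FF /cvg_nrmP /(_ 1 ltr01) h; exists (1 + nrm A).
apply: filterS h => t /= ht; rewrite -[f t](subrK A).
by apply: le_trans (nrmD _ _) _; rewrite lerD2r ltW.
Qed.

(** Bolzano-Weierstrass entry by entry; an ultrafilter takes the place of the extraction of
    subsequences. *)
Lemma bnd_cvg f : UltraFilter F -> bnd F f -> exists A, f @ F --> A.
Proof.
move=> FU [K FK].
have h i j : exists a, forall e, 0 < e -> F [set t | `|f t i j - a| < e].
  apply: (@ultra_lim_complex _ K) => //; apply: filterS FK => t /=.
  by apply: le_trans; exact: nrm_entry.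
pose A : M := \matrix_(i, j) projT1 (cid (h i j)); exists A.
apply/cvg_ballP => e e0.
have : F [set t | forall ij : 'I_m.+1 * 'I_m.+1, `|f t ij.1 ij.2 - A ij.1 ij.2| < e].
  have hh (ij : 'I_m.+1 * 'I_m.+1) : F [set t | `|f t ij.1 ij.2 - A ij.1 ij.2| < e].
    by rewrite mxE; case: cid => a /= ha; exact: ha.
  exact: filter_forall hh.
apply: filterS => t ht; split=> // i j.
by rewrite /ball /= distrC; exact: (ht (i, j)).
Qed.

End Limits.

(** * Bounds in the Lie algebra along an ultrafilter *)

Section LieAlgebraBound.
Variables (R : realType) (m : nat).
Local Notation C := R[i].
Local Notation M := 'M[C]_m.+1.
Variables (T : Type) (F : set_system T).
Hypothesis FU : UltraFilter F.
Let FP : ProperFilter F := ultra_proper.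
Let FF : Filter F := @filter_filter _ _ FP.
Variables gv vv hv : {vspace M}.
Hypotheses (vg : (vv <= gv)%VS) (hg : (hv <= gv)%VS).
Hypotheses (gbr : forall A B, A \in gv -> B \in gv -> br A B \in gv)
           (vbr : forall A B, A \in vv -> B \in vv -> br A B \in vv)
           (hbr : forall A B, A \in hv -> B \in hv -> br A B \in hv).
Hypothesis g4 : forall a b c d, a \in gv -> b \in gv -> c \in gv -> d \in gv ->
  br a (br b (br c d)) = 0.

(** Infinitesimal freeness: no conjugate of [vv] meets [hv] outside 0. *)
Hypothesis free : forall Z A, Z \in gv -> A \in vv -> exp_ad Z A \in hv -> A = 0.

(** The defect [p] of the projection vanishes on [U] and is Lipschitz, so it vanishes at the
    limit. *)
Lemma lim_mem (f : T -> M) (S : set T) A (U : {vspace M}) : F S ->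
  (forall t, S t -> f t \in U) -> f @ F --> A -> A \in U.
Proof.
move=> FS fU /(@cvg_nrmP _ _ _ _ _ _ FF) h.
pose p B := B - projv U B.
have lp : linear p.
  by move=> a x y; rewrite /p linearP scalerBr opprD addrACA.
suff p0 : p A = 0 by move/eqP: p0; rewrite subr_eq0 => /eqP ->; exact: memv_proj.
have [c c0 hc] := linear_bound lp.
apply: nrm_eq0; apply/eqP/negPn/negP => nz.
have n0 : 0 < nrm (p A) by rewrite lt_neqAle eq_sym nz nrm_ge0.
have c1 : 0 < c + 1 by rewrite ltr_wpDl.
have [t [St /= ht]] := filter_ex (filterI FS (h _ (divr_gt0 n0 c1))).
have e : p A = - p (f t - A).
  have pB x y : p (x - y) = p x - p y by rewrite /p linearB !opprD addrACA.
  by rewrite pB {2}/p (projv_id (fU _ St)) subrr sub0r opprK.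
move: ht; rewrite ltr_pdivlMr // e nrmN mulrC => ht.
have h3 : c * nrm (f t - A) <= (c + 1) * nrm (f t - A).
  by rewrite ler_wpM2r ?nrm_ge0 // lerDl.
by have := le_lt_trans (hc (f t - A)) (le_lt_trans h3 ht); rewrite ltxx.
Qed.

(** At the limit [Z0] of [Z], freeness makes [Ad(exp Z0)] modulo [hv] injective on [vv], so it has a
    bounded linear left inverse there. The error from [Z t] to [Z0] is a small multiple of the norm
    of [A] and is absorbed. *)
Lemma exp_ad_bound (S : set T) (Z A B : T -> M) : F S ->
  (forall t, S t -> [/\ Z t \in gv, A t \in vv & B t \in hv]) ->
  bnd F Z -> bnd F (fun t => B t - exp_ad (Z t) (A t)) ->
  bnd F A /\ bnd F B.
Proof.
move=> FS mem bZ bE.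
have [Z0 ZZ0] := bnd_cvg FU bZ.
have Z0g : Z0 \in gv by apply: lim_mem FS _ ZZ0 => t /mem[].
pose p X := X - projv hv X.
have lp : linear p.
  by move=> a x y; rewrite /p linearP scalerBr opprD addrACA.
have [f fE] : exists f : 'Hom(M, M), forall X, f X = p (exp_ad Z0 X).
  by apply: hom_of_linear => a x y; rewrite exp_ad_linear lp.
have [g gE] := linear_section f vv.
have gK X : X \in vv -> g (f X) = X.
  move=> Xv; have [gv1 fg] := gE _ Xv; apply/eqP; rewrite -subr_eq0; apply/eqP.
  apply: (free Z0g); first exact: rpredB.
  have : f (g (f X) - X) = 0 by rewrite linearB /= fg subrr.
  by rewrite fE /p => /eqP; rewrite subr_eq0 => /eqP ->; exact: memv_proj.
have [c c0 hc] : exists2 c, 0 <= c & forall X, nrm (g (p X)) <= c * nrm X.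
  by apply: linear_bound => a x y; rewrite lp linearP.
case: bE => K hK; case: (bZ) => L hL.
(* This is [2 + (4 L + 4 nrm Z0) / 2], collected from [exp_ad_diff] with the factor 2 of [nrm_br]
   for each bracket. *)
pose q := 2%:R + 2%:R * (L + nrm Z0).
have hd t : nrm (Z t) <= L -> 0 <= q /\ nrm (exp_ad (Z t) (A t) - exp_ad Z0 (A t))
     <= q * nrm (Z t - Z0) * nrm (A t).
  move=> hZ; set d := Z t - Z0.
  have L0 : 0 <= L by apply: le_trans hZ; exact: nrm_ge0.
  have q0 : 0 <= q by rewrite addr_ge0 // mulr_ge0 // addr_ge0 // nrm_ge0.
  split=> //; rewrite exp_ad_diff -/d.
  have h1 X Y (a b : C) : nrm X <= a -> nrm Y <= b -> nrm (br X Y) <= 2%:R * (a * b).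
    move=> hX hY; apply: le_trans (nrm_br _ _) _; rewrite -mulrA ler_pM2l //.
    by apply: ler_pM => //; exact: nrm_ge0.
  apply: le_trans (nrmD _ _) _; rewrite nrmZ.
  apply: (@le_trans _ _ (2%:R * (nrm d * nrm (A t)) + `|2%:R^-1| *
    (2%:R * (nrm d * (2%:R * (L * nrm (A t)))) + 2%:R * (nrm Z0 * (2%:R * (nrm d * nrm (A t))))))).
    apply: lerD; first exact: h1.
    apply: ler_wpM2l => //; apply: le_trans (nrmD _ _) _.
    by apply: lerD; apply: (h1) => //; apply: (h1).
  rewrite ger0_norm ?invr_ge0 // le_eqVlt; apply/orP; left; apply/eqP.
  by rewrite /q; field.
have bA : bnd F A.
  exists (2%:R * (c * K)).
  have [t0 [St0 [hK0 hL0]]] := filter_ex (filterI FS (filterI hK hL)).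
  have [q0 _] := hd _ hL0.
  (* The radius [1 / (2 (c q + 1))] makes [c q nrm (Z t - Z0)] at most [1/2], and adding 1 covers
     [c q = 0]. Then [nrm A <= c K + nrm A / 2], whence the bound [2 c K]. *)
  have s0 : 0 < 2%:R * (c * q + 1) :> C by rewrite mulr_gt0 // ltr_wpDl // mulr_ge0.
  have hZ := (@cvg_nrmP _ _ _ _ _ _ FF).1 ZZ0 _ (divr_gt0 ltr01 s0).
  apply: filterS (filterI (filterI FS hK) (filterI hL hZ)) => t [[St /= hKt] [/= hLt hZt]].
  have [Zg Av Bh] := mem _ St; have [_ hdt] := hd _ hLt.
  move: hKt hdt; set E := B t - _; set D := exp_ad _ _ - _ => hKt hdt.
  have eA : f (A t) = p (- 1 *: (E + D)).
    rewrite fE (_ : exp_ad Z0 (A t) = -1 *: (E + D) + B t); last first.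
      by rewrite scaleN1r /E /D addrA subrK opprB subrK.
    have pB : p (B t) = 0 by rewrite /p projv_id // subrr.
    by rewrite -[X in X + B t]scale1r lp scale1r pB addr0.
  have : nrm (A t) <= c * K + 2%:R^-1 * nrm (A t).
    rewrite -{1}(gK _ Av) eA; apply: le_trans (hc _) _; rewrite scaleN1r nrmN.
    apply: (@le_trans _ _ (c * (K + q * nrm (Z t - Z0) * nrm (A t)))).
      by apply: ler_wpM2l => //; apply: le_trans (nrmD _ _) _; apply: lerD.
    rewrite mulrDr lerD2l !mulrA; apply: ler_wpM2r; first exact: nrm_ge0.
    move: hZt; rewrite ltr_pdivlMr // => /ltW; set n := nrm _ => hn.
    rewrite -[leRHS]mul1r ler_pdivlMr //; apply: le_trans hn.
    have -> : n * (2%:R * (c * q + 1)) = c * q * n * 2%:R + 2%:R * n by ring.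
    by rewrite lerDl mulr_ge0 // nrm_ge0.
  rewrite -lerBlDr -{1}[nrm (A t)]mul1r -mulrBl => h.
  rewrite -ler_pdivrMl // ; apply: le_trans h; rewrite le_eqVlt; apply/orP; left.
  by apply/eqP; congr (_ * _); field.
split=> //.
have bZA : bnd F (fun t => exp_ad (Z t) (A t)).
  by apply: bndD => //; [apply: bndD => //|apply/bndZ]; do !apply: bnd_br.
apply: (bnd_eq FF FS _ (bndD FF (ex_intro _ K hK) bZA)) => t St.
by rewrite subrK.
Qed.

(** Freeness enters twice through [exp_ad_bound]: first for [xi + cv], then with [Z = 0] to isolate
    [cv]. *)
Lemma lie_algebra_bound (S : set T) (X Y D W : T -> M) : F S ->
  (forall t, S t -> [/\ X t \in vv, Y t \in hv, D t \in gv & W t \in gv]) ->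
  (forall t, S t -> let X' := exp_ad (W t) (X t) in
    Y t = X' + 2%:R *: D t +
      6%:R^-1 *: (br X' (br X' (D t)) - br (D t) (br (D t) X'))) ->
  bnd F D -> bnd F W -> bnd F X.
Proof.
move=> FS mem hY0 bD bW.
have vgP A : A \in vv -> A \in gv by apply: (subvP vg).
have hgP A : A \in hv -> A \in gv by apply: (subvP hg).
(* Inside triple brackets [X'] may be replaced by [X], from which it differs by an element of the
   second centre. *)
have hY t : S t -> Y t = exp_ad (W t) (X t) + 2%:R *: D t +
      6%:R^-1 *: (br (X t) (br (X t) (D t)) - br (D t) (br (D t) (X t))).
  move=> St; have [Xv Yh Dg Wg] := mem _ St; rewrite {1}(hY0 _ St) /=.
  have z := exp_ad_z2 gbr g4 Wg (vgP _ Xv).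
  have z0 A : z2 gv (A - A) by rewrite subrr; exact: z2_0.
  have Xg := vgP _ Xv.
  by rewrite (br3_z2 Xg Xg Dg z z (z0 _)) (br3_z2 Dg Dg Xg (z0 _) (z0 _) z).
(* a linear choice of (L, YL) with L in v, YL in h and YL = L + 2 D up to z2 *)
have [U UE] : exists U : {vspace (M * M * M)%type}, forall x, x \in U <->
    [/\ x.1.1 \in vv, x.1.2 \in gv, x.2 \in hv & z2 gv (x.2 - (x.1.1 + 2%:R *: x.1.2))].
  apply: vspace_of_set.
    by rewrite /= !rpred0; split=> //; rewrite scaler0 addr0 subr0; exact: z2_0.
  move=> a [[x1 x2] x3] [[y1 y2] y3] /= [h1 h2 h3 h4] [k1 k2 k3 k4].
  split; rewrite ?rpredD ?rpredZ //.
  have := z2_lin a h4 k4; congr (z2 gv _).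
  exact: lin_sub2.
have [f fE] : exists f : 'Hom((M * M * M)%type, M), forall x, f x = x.1.2.
  by apply: hom_of_linear => a x y.
have [g gE] := linear_section f U.
pose L t := (g (D t)).1.1; pose YL t := (g (D t)).2.
have memL t : S t -> [/\ L t \in vv, YL t \in hv & z2 gv (YL t - (L t + 2%:R *: D t))].
  move=> St; have [Xv Yh Dg Wg] := mem _ St.
  (* The given triple shows that [D t] is in the image of [U], so the section applies to it. *)
  have xU : (X t, D t, Y t) \in U.
    by apply/UE; split=> //=; rewrite hY //; apply: bch_z2 => //; exact: vgP.
  have := gE _ xU; rewrite [f (X t, D t, Y t)]fE fE /= => -[/UE[h1 h2 h3 h4] e].
  by rewrite e in h4; split.
have bL : bnd F L.
  by apply: (bnd_linear FF (h := fun A => (g A).1.1)) bD => a x y; rewrite linearP.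
pose xi t := X t - L t; pose eta t := Y t - YL t.
pose cv t := - 6%:R^-1 *: (2%:R^-1 *: br (xi t) (br (xi t) (L t))
  + 4%:R^-1 *: br (L t) (br (xi t) (L t))).
pose ch t := 6%:R^-1 *: (2%:R^-1 *: br (eta t) (br (eta t) (YL t))
  + 4%:R^-1 *: br (YL t) (br (eta t) (YL t))).
pose Z t := W t - 4%:R^-1 *: br (L t) (D t).
pose bch (V P Q : M) : M := exp_ad V P + 2%:R *: Q + 6%:R^-1 *: (br P (br P Q) - br Q (br Q P)).
have bnd_exp_ad (V P : T -> M) : bnd F V -> bnd F P -> bnd F (fun t => exp_ad (V t) (P t)).
  by move=> bV bP; apply: bndD => //; [apply: bndD => //|apply/bndZ]; do !apply: bnd_br.
have bnd_bch (P : T -> M) : bnd F P -> bnd F (fun t => bch (W t) (P t) (D t)).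
  move=> bP; apply: bndD => //; first by apply: bndD => //; [exact: bnd_exp_ad | exact: bndZ].
  by apply/bndZ/bndB => //; do !apply: bnd_br.
have xiv t : S t -> xi t \in vv.
  by move=> St; have [? _ _ _] := mem _ St; have [? _ _] := memL _ St; rewrite rpredB.
have cvv t : S t -> cv t \in vv.
  move=> St; have [Lv _ _] := memL _ St; have xv := xiv _ St.
  by rewrite rpredZ // rpredD // rpredZ // !vbr.
have chh t : S t -> ch t \in hv.
  move=> St; have [_ Lh _] := memL _ St; have [_ Yh _ _] := mem _ St.
  have eh : eta t \in hv by rewrite rpredB.
  by rewrite rpredZ // rpredD // rpredZ // !hbr.
have keyE t : S t ->
    bch (W t) (L t) (D t) = Y t - ch t - exp_ad (Z t) (xi t + cv t).
  move=> St; have [Xv Yh Dg Wg] := mem _ St; have [Lv Lh zL] := memL _ St.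
  apply/esym; apply: (key_identity gbr g4 Wg (vgP _ (xiv _ St)) (vgP _ Lv) Dg zL).
  by rewrite /xi subrK; exact: hY.
have [bA bB] : bnd F (fun t => xi t + cv t) /\ bnd F (fun t => Y t - ch t).
  apply: (@exp_ad_bound S Z) => //.
  - move=> t St; have [Xv Yh Dg Wg] := mem _ St; have [Lv Lh zL] := memL _ St.
    have Lg := vgP _ Lv; have xv := xiv _ St; have c1 := cvv _ St; have c2 := chh _ St.
    by split; [rewrite rpredB // rpredZ // gbr | rewrite rpredD | rewrite rpredB].
  - by apply: bndB => //; apply/bndZ/bnd_br.
  - exact: (bnd_eq FF FS keyE (bnd_bch _ bL)).
pose P t := xi t + cv t + L t.
have bP : bnd F P by exact: bndD.
have PE t : P t = X t + cv t by rewrite /P /xi addrAC subrK.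
(* As [P = X + cv] with [cv] central, passing from [X] to [P] only adds [cv]. The bounded left side
   is thus [ch + cv], written as [B - Ad(1) A] with [A = - cv] and [B = ch]. *)
have sumE t : S t -> bch (W t) (P t) (D t) - (Y t - ch t) = ch t - exp_ad 0 (- cv t).
  move=> St; have [Xv Yh Dg Wg] := mem _ St; have [Lv Lh zL] := memL _ St.
  have Lg := vgP _ Lv; have xg := vgP _ (xiv _ St); have Xg := vgP _ Xv.
  have zcv : z2 gv (P t - X t).
    rewrite PE addrC addKr /cv; apply: z2Z; apply: z2D; apply: z2Z; apply: z2_br => //; exact: gbr.
  have z0 A : z2 gv (A - A) by rewrite subrr; exact: z2_0.
  have Wcv : br (W t) (cv t) = 0.
    by rewrite /cv brZr brDr !brZr !g4 // !scaler0 addr0 scaler0.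
  have e : exp_ad (W t) (P t) = exp_ad (W t) (X t) + cv t.
    by rewrite PE /exp_ad brDr Wcv addr0 [X t + cv t]addrC -!addrA addrC !addrA.
  have e0 : exp_ad 0 (- cv t) = - cv t.
    by rewrite /exp_ad !br0l scaler0 !addr0.
  rewrite e0 opprK /bch e (br3_z2 Xg Xg Dg zcv zcv (z0 _)).
  rewrite (br3_z2 Dg Dg Xg (z0 _) (z0 _) zcv).
  rewrite (_ : Y t - ch t = exp_ad (W t) (X t) + 2%:R *: D t + 6%:R^-1 *:
    (br (X t) (br (X t) (D t)) - br (D t) (br (D t) (X t))) - ch t); last by rewrite hY.
  exact: sub_shift.
have bcv : bnd F (fun t => - cv t).
  have b0 : bnd F (fun=> 0 : M) by exact: bnd_cst.
  suff [] : bnd F (fun t => - cv t) /\ bnd F ch by [].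
  apply: (exp_ad_bound FS _ b0 (bnd_eq FF FS sumE (bndB FF (bnd_bch _ bP) bB))).
  by move=> t St; split; [exact: rpred0 | rewrite rpredN; exact: cvv | exact: chh].
apply: (bnd_eq FF FS _ (bndD FF bP bcv)) => t _.
by rewrite PE addrK.
Qed.
End LieAlgebraBound.

(** * Properness of the action *)

Section Closed.
Variables (C : numFieldType) (m : nat).
Local Notation M := 'M[C]_m.+1.
Variables (T : Type) (F : set_system T).
Hypothesis FP : ProperFilter F.
Let FF : Filter F := @filter_filter _ _ FP.
Implicit Types (f g : T -> M) (A B : M).

Lemma cvg_entry f A i j : f @ F --> A -> (f t i j : C) @[t --> F] --> (A i j : C).
Proof.
exact: (@continuous_cvg T M C F FF f (fun B : M => B i j) A
  (@coord_continuous C m.+1 m.+1 i j A)).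
Qed.

Lemma cvg_bigsum (I : Type) (r : seq I) (u : I -> T -> C) (a : I -> C) :
  (forall i, u i t @[t --> F] --> a i) ->
  (\sum_(i <- r) u i t) @[t --> F] --> \sum_(i <- r) a i.
Proof.
move=> h; elim: r => [|i r IH].
  by under eq_fun do rewrite big_nil; rewrite big_nil; exact: cvg_cst.
by under eq_fun do rewrite big_cons; rewrite big_cons; apply: cvgD.
Qed.

Lemma cvg_bigprod (I : Type) (r : seq I) (u : I -> T -> C) (a : I -> C) :
  (forall i, u i t @[t --> F] --> a i) ->
  (\prod_(i <- r) u i t) @[t --> F] --> \prod_(i <- r) a i.
Proof.
move=> h; elim: r => [|i r IH].
  by under eq_fun do rewrite big_nil; rewrite big_nil; exact: cvg_cst.
by under eq_fun do rewrite big_cons; rewrite big_cons; apply: cvgM.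
Qed.

Lemma cvg_expn (u : T -> C) (a : C) k : u t @[t --> F] --> a ->
  (u t ^+ k) @[t --> F] --> a ^+ k.
Proof.
move=> h; elim: k => [|k IH].
  by under eq_fun do rewrite expr0; rewrite expr0; exact: cvg_cst.
by under eq_fun do rewrite exprS; rewrite exprS; apply: cvgM.
Qed.

Lemma cvg_eq_near (u v : T -> C) (a b : C) (S : set T) : F S ->
  (forall t, S t -> u t = v t) -> u t @[t --> F] --> a -> v t @[t --> F] --> b ->
  a = b.
Proof.
move=> FS h ha hb.
have hb' : u t @[t --> F] --> b.
  apply: cvg_trans hb; apply: near_eq_cvg; apply: filterS FS => t St.
  by rewrite h.
exact: (cvg_unique _ ha hb').
Qed.

Lemma cvg_mulmx f g A B : f @ F --> A -> g @ F --> B -> forall i j,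
  ((f t * g t) i j : C) @[t --> F] --> ((A * B) i j : C).
Proof.
move=> hf hg i j; under eq_fun do rewrite mxE; rewrite mxE.
by apply: cvg_bigsum => k; apply: cvgM; exact: cvg_entry.
Qed.

Lemma cvg_meval f A (p : mpoly.mpoly (m.+1 * m.+1) C) : f @ F --> A ->
  mpoly.meval (fun k => mxvec (f t) 0 k) p @[t --> F]
    --> mpoly.meval (fun k => mxvec A 0 k) p.
Proof.
move=> fA; under eq_fun do rewrite mpoly.mevalE; rewrite mpoly.mevalE.
apply: cvg_bigsum => n; apply: cvgM; first exact: cvg_cst.
apply: cvg_bigprod => k; apply: cvg_expn.
case/mxvec_indexP: k => i j; rewrite mxvecE; under eq_fun do rewrite mxvecE.
exact: cvg_entry.
Qed.
End Closed.

Section ClosedComplex.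
Variables (R : realType) (m : nat).
Local Notation C := R[i].
Local Notation M := 'M[C]_m.+1.
Variables (T : Type) (F : set_system T).
Hypothesis FP : ProperFilter F.
Implicit Types (f g : T -> M) (A B : M).

(** Polynomials are continuous, so their common zero sets are closed. *)
Lemma algebraic_set_lim (Z : set M) (S : set T) f A : algebraic_set Z -> F S ->
  (forall t, S t -> Z (f t)) -> f @ F --> A -> Z A.
Proof.
move=> [P ->] FS h fA p Pp.
have := @cvg_meval C m T F FP f A p fA => hc.
apply: (@cvg_eq_near C T F FP _ (fun=> 0) _ _ S FS _ hc (cvg_cst _)).
by move=> t St; exact: h.
Qed.

Lemma mulmx_lim (S : set T) (f g f' g' : T -> M) A B A' B' : F S ->
  (forall t, S t -> f t * g t = f' t * g' t) ->
  f @ F --> A -> g @ F --> B -> f' @ F --> A' -> g' @ F --> B' -> A * B = A' * B'.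
Proof.
move=> FS h fA gB fA' gB'; apply/matrixP => i j.
have h1 := @cvg_mulmx C m T F FP f g A B fA gB i j.
have h2 := @cvg_mulmx C m T F FP f' g' A' B' fA' gB' i j.
apply: (@cvg_eq_near C T F FP _ _ _ _ S FS _ h1 h2).
by move=> t St; rewrite h.
Qed.
End ClosedComplex.

Lemma unit_nexp (C : numFieldType) m (X : 'M[C]_m.+1) : lev 1 X -> nexp X \in unitmx.
Proof.
by move=> lX; apply/unitrP; exists (nexp (- X)); rewrite nexpNK // nexpKN.
Qed.

Lemma mulmx_unit_eq (C : comUnitRingType) m (A B D E : 'M[C]_m.+1) : D \in unitmx ->
  A * B = E * D -> A *m B *m invmx D = E.
Proof. by move=> u e; rewrite -[A *m B]/(A * B) e [E * D]/(E *m D) mulmxK. Qed.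

Lemma conj_inv_eq (A : pzRingType) (z z' v : A) : z' * z = 1 ->
  v * z' = z' * (z * v * z').
Proof. by move=> e; rewrite !mulrA e mul1r. Qed.

(** Here [b'] is the inverse of [b], [d] a square root of [b' g], and [w] the inverse of the
    midpoint [b d]. The relation [h = b' v g] takes the symmetric shape that [nexp_sym] handles. *)
Lemma midpoint_eq (A : pzRingType) (b b' g d v h w : A) :
  b * b' = 1 -> b' * b = 1 -> d * d = b' * g -> w * (b * d) = 1 -> b * d * w = 1 ->
  v * g = b * h -> h = d * (w * v * (b * d)) * d.
Proof.
move=> bb bb' dd wm mw e.
have dw : d * w = b'.
  by rewrite -[LHS]mul1r -bb' -!mulrA [b * (d * w)]mulrA mw mulr1.
have bdd : b * d * d = g by rewrite -mulrA dd mulrA bb mul1r.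
by rewrite -[h in LHS]mul1r -bb' -mulrA -e -dw -{1}bdd !mulrA.
Qed.

Lemma lev_bch (C : numFieldType) m (X D : 'M[C]_m.+1) : lev 1 X -> lev 1 D ->
  lev 1 (X + 2%:R *: D + 6%:R^-1 *: (br X (br X D) - br D (br D X))).
Proof.
move=> lX lD; do !apply: levD => //; apply: levZ => //.
by apply: levB; do !apply: lev_br1.
Qed.

Lemma half_double (C : numFieldType) m (X : 'M[C]_m.+1) :
  2%:R^-1 *: X + 2%:R^-1 *: X = X.
Proof. by rewrite -scalerDl -[2%:R^-1]div1r -splitr scale1r. Qed.

(** * Transfer from the group to its Lie algebra, and compactness *)

Section Main.
Variables (R : realType) (m : nat).
Local Notation C := R[i].
Local Notation M := 'M[C]_m.+1.
Variables (G V H : set M).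
Hypotheses (hG : unipotent_lie_group G) (hV : algebraic_subgroup V G)
  (hH : algebraic_subgroup H G).
Hypothesis hfree : free_action (1%:M, 1%:M) (V `*` H) G (@two_sided_act R m.+1).
Hypothesis g4 : nil4 (log_set G).

Let hGG : algebraic_subgroup G G := unipotent_subgroup hG.

Lemma log_set_vspace (K : set M) : algebraic_subgroup K G ->
  exists U : {vspace M}, forall X, X \in U <-> log_set K X.
Proof.
move=> hK; apply: vspace_of_set; first exact: (log_set0 hK).
by move=> a x y hx hy; apply: (log_setD hK g4) => //; exact: (log_setZ hK).
Qed.

(** The pair [(exp A, exp(Ad(exp Z) A))] fixes [exp(-Z)], so freeness gives [exp A = 1], and the
    exponential is injective. *)
Lemma log_set_free (Z A : M) : log_set G Z -> log_set V A -> log_set H (exp_ad Z A) ->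
  A = 0.
Proof.
move=> gZ vA hE; have [lZ GZ] := gZ; have [lA VA] := vA; have [lE HE] := hE.
have gA := log_set_sub hV vA.
have eE : nexp (exp_ad Z A) = nexp Z * nexp A * nexp (- Z).
  by rewrite -(nexp_conj _ (nexpNK lZ) (nexpKN lZ)) (nexp_Ad lZ (g4 gZ gZ gZ gA)).
have [_ GZ'] := log_setN hGG gZ.
have act : two_sided_act (nexp A, nexp (exp_ad Z A)) (nexp (- Z)) = nexp (- Z).
  apply: (mulmx_unit_eq (unit_nexp lE)).
  by rewrite eE; exact: conj_inv_eq (nexpKN lZ).
have VH : (V `*` H) (nexp A, nexp (exp_ad Z A)) by split.
have [e _] := hfree VH GZ' act.
apply: nexp_inj => //; first exact: lev0.
by rewrite e nexp0.
Qed.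

(** Logarithm of [midpoint_eq]: [exp(2D)] is [b^-1 g], and [exp W] is the inverse of the midpoint
    [b exp D]. *)
Lemma log_bch (v h g b : M) : V v -> H h -> G g -> G b -> v * g = b * h ->
  let D := 2%:R^-1 *: nlog (nexp (- nlog b) * g) in
  let W := - nlog (b * nexp D) in let X' := exp_ad W (nlog v) in
  [/\ log_set G D, log_set G W &
   nlog h = X' + 2%:R *: D + 6%:R^-1 *: (br X' (br X' D) - br D (br D X'))].
Proof.
move=> Vv Hh Gg Gb e.
have GM A B : G A -> G B -> G (A * B) by case: hGG => _ _ _ GM _; exact: GM.
have nl A : G A -> log_set G (nlog A) /\ nexp (nlog A) = A.
  move=> GA; split; first exact: (log_set_nlog hG hGG).
  by apply: nlogK; exact: (unipotent_lev hG hGG).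
move: (nl _ Gb); set be := nlog b => -[gbe ebe]; have [lbe _] := gbe.
have Gc : G (nexp (- be) * g) by apply: GM => //; have [] := log_setN hGG gbe.
move=> D; have [gc ec] := nl _ Gc.
have gD : log_set G D by exact: (log_setZ hGG).
have [lD GD] := gD.
have edd : nexp D * nexp D = nexp (- be) * g.
  by rewrite -(nexpD lD lD (brxx D)) -ec half_double.
clearbody D.
have Gm : G (b * nexp D) by exact: GM.
move=> W; have [gm em] := nl _ Gm; have [lm _] := gm.
have gW : log_set G W by exact: (log_setN hGG).
have [lW _] := gW.
have Gv : G v by case: hV => sV _ _ _ _; exact: sV.
have Gh : G h by case: hH => sH _ _ _ _; exact: sH.
have [gX eX] := nl _ Gv; have [gY eY] := nl _ Gh.
move=> X'.
have eX' : X' = nexp W * nlog v * nexp (- W) by rewrite (nexp_Ad lW (g4 gW gW gW gX)).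
have gX' : log_set G X' by exact: (log_set_conj hGG g4 gW gX).
have eeX' : nexp X' = nexp W * v * nexp (- W).
  by rewrite eX' (nexp_conj _ (nexpNK lW) (nexpKN lW)) eX.
split=> //; have [lY _] := gY; have [lX' _] := gX'.
have sy := nexp_sym lX' lD (g4 gX' gX' gX' gD) (g4 gD gX' gX' gD)
  (g4 gX' gD gX' gD) (g4 gD gD gX' gD).
apply: (nexp_inj lY (lev_bch lX' lD)).
rewrite -sy eY eeX' /W opprK em.
have mW := nexpKN lm; have Wm := nexpNK lm; rewrite em in mW Wm.
have b1 := nexpNK lbe; have b2 := nexpKN lbe; rewrite ebe in b1 b2.
exact: midpoint_eq b1 b2 edd mW Wm e.
Qed.

(** Both [D] and [W] are functions of [g] and [b] alone, hence bounded, and [lie_algebra_bound]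
    applies. *)
Lemma log_bound (T : Type) (F : set_system T) (S : set T) (v h g b : T -> M) :
  UltraFilter F -> F S ->
  (forall t, S t -> [/\ V (v t), H (h t), G (g t), G (b t) & v t * g t = b t * h t]) ->
  bnd F g -> bnd F b -> bnd F (fun t => nlog (v t)).
Proof.
move=> FU FS mem bg bb.
have FF : Filter F := @filter_filter _ _ ultra_proper.
have [gv gvP] := log_set_vspace hGG.
have [vv vvP] := log_set_vspace hV.
have [hv hvP] := log_set_vspace hH.
have bD : bnd F (fun t => 2%:R^-1 *: nlog (nexp (- nlog (b t)) * g t)).
  by apply/bndZ/bnd_nlog/bndM => //; apply/bnd_nexp/bndN/bnd_nlog.
have bW : bnd F (fun t => - nlog (b t *
    nexp (2%:R^-1 *: nlog (nexp (- nlog (b t)) * g t)))).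
  by apply/bndN/bnd_nlog/bndM => //; exact: bnd_nexp.
apply: (@lie_algebra_bound R m T F FU gv vv hv _ _ _ _ _ _ _ S _
  (fun t => nlog (h t)) _ _ FS _ _ bD bW).
- by apply/subvP => X /vvP h1; apply/gvP; exact: log_set_sub hV _ h1.
- by apply/subvP => X /hvP h1; apply/gvP; exact: log_set_sub hH _ h1.
- by move=> X Y /gvP h1 /gvP h2; apply/gvP; exact: (log_set_br hGG g4).
- by move=> X Y /vvP h1 /vvP h2; apply/vvP; exact: (log_set_br hV g4).
- by move=> X Y /hvP h1 /hvP h2; apply/hvP; exact: (log_set_br hH g4).
- by move=> X Y Z W /gvP h1 /gvP h2 /gvP h3 /gvP h4; exact: g4.
- by move=> Z A /gvP h1 /vvP h2 /hvP h3; exact: log_set_free h1 h2 h3.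
- move=> t St; have [Vv Hh Gg Gb e] := mem _ St.
  have [h1 h2 _] := log_bch Vv Hh Gg Gb e; split.
  + by apply/vvP; exact: (log_set_nlog hG hV).
  + by apply/hvP; exact: (log_set_nlog hG hH).
  + by apply/gvP.
  + by apply/gvP.
- move=> t St; have [Vv Hh Gg Gb e] := mem _ St.
  by have [_ _] := log_bch Vv Hh Gg Gb e.
Qed.

Lemma two_sided_act_proper : proper_action (V `*` H) G (@two_sided_act R m.+1).
Proof.
move=> K KG cK; rewrite compact_ultra => F FU FS.
set S := (X in F X) in FS.
have FP : ProperFilter F := @ultra_proper _ F FU.
have FF : Filter F := @filter_filter _ _ FP.
pose v (t : M * M * M) := t.1.1; pose h (t : M * M * M) := t.1.2.
pose g (t : M * M * M) := t.2; pose b (t : M * M * M) := two_sided_act t.1 t.2.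
have SK t : S t -> K (g t, b t) by case=> _.
(* Compactness of [K] makes the point [g] and its image [b] converge together. *)
have [[g0 b0] [K0 cvgK]] : K `&` [set p | (fun t => (g t, b t)) @ F --> p] !=set0.
  move: cK; rewrite compact_ultra; apply; first exact: ultra_fmap.
  exact: filterS SK FS.
have [Gg0 Gb0] := KG _ K0.
have cg : g @ F --> g0  by exact: (cvg_comp _ _ cvgK (@cvg_fst _ _ _ _ _)).
have cb : b @ F --> b0  by exact: (cvg_comp _ _ cvgK (@cvg_snd _ _ _ _ _)).
have uH A : H A -> A \in unitmx.
  move=> HA; rewrite -(nlogK (unipotent_lev hG hH HA)); apply: unit_nexp.
  exact/lev_nlog/(unipotent_lev hG hH HA).
have mem t : S t -> [/\ V (v t), H (h t), G (g t), G (b t) & v t * g t = b t * h t].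
  move=> [[[Vv Hh] Gg] Kt]; have [_ Gb] := KG _ Kt.
  split=> //; rewrite /b /two_sided_act.
  by rewrite -[RHS]/(_ *m _) mulmxKV //; exact: uH.
have bg := cvg_bnd FF cg; have bb := cvg_bnd FF cb.
have bX := log_bound FU FS mem bg bb.
have bv : bnd F v.
  apply: (bnd_eq FF FS _ (bnd_nexp FF bX)) => t St; have [Vv _ _ _ _] := mem _ St.
  exact: nlogK (unipotent_lev hG hV Vv).
(* Here [h = b^-1 v g], with all three factors bounded. *)
have bh : bnd F h.
  have bb' : bnd F (fun t => nexp (- nlog (b t))) by apply/bnd_nexp/bndN/bnd_nlog.
  apply: (bnd_eq FF FS _ (bndM FF bb' (bndM FF bv bg))) => t St.
  have [_ _ _ Gb ->] := mem _ St; have lb := unipotent_lev hG hGG Gb.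
  by rewrite mulrA -{2}(nlogK lb) nexpKN ?mul1r //; exact: lev_nlog.
have [v0 cv] := bnd_cvg FU bv; have [h0 ch] := bnd_cvg FU bh.
have algV : algebraic_set V by case: hV.
have algH : algebraic_set H by case: hH.
have Vv0 : V v0 by apply: (algebraic_set_lim FP algV FS _ cv) => t /mem[].
have Hh0 : H h0 by apply: (algebraic_set_lim FP algH FS _ ch) => t /mem[].
have e0 : v0 * g0 = b0 * h0.
  by apply: (mulmx_lim FP FS _ cv cg cb ch) => t /mem[].
(* The limits satisfy [v0 g0 = b0 h0] with [v0] in [V] and [h0] in [H], so this point is sent to
   [(g0, b0)], which lies in [K]. *)
exists ((v0, h0), g0); split; last first.
  have cvh : (fun t => (v t, h t)) @ F --> (v0, h0) by exact: cvg_pair cv ch.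
  have cvhg : (fun t => ((v t, h t), g t)) @ F --> ((v0, h0), g0).
    exact: cvg_pair cvh cg.
  have eid : (fun t => ((v t, h t), g t)) = id by apply/funext => -[[]].
  by rewrite eid in cvhg; exact: cvhg.
split; first by split.
have e1 : two_sided_act (v0, h0) g0 = b0 by exact: mulmx_unit_eq (uH _ Hh0) e0.
by rewrite /preimage /= e1.
Qed.
End Main.

Unset Implicit Arguments.

Theorem corollary3 (R : realType) (n : nat) (G V H : set 'M[R[i]]_n)
  (hG : unipotent_lie_group G)
  (hGconn : connected G)
  (hGsc : simply_connected R G)
  (hV : algebraic_subgroup V G)
  (hH : algebraic_subgroup H G)
  (hfree : free_action (1%:M, 1%:M) (V `*` H) G (@two_sided_act R n))
  (hstep : step_nilpotent 3 (lie_algebra G)) :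
  proper_action (V `*` H) G (@two_sided_act R n).
Proof.
move: hG hV hH hfree hstep {hGconn hGsc}.
case: n G V H => [|m] G V H hG hV hH hfree hstep; last first.
  exact: two_sided_act_proper hG hV hH hfree (nil4_log_set hG hstep).
(* In size 0 all matrices coincide, so the Lie algebra is already [{0}] at index 0, against the
   minimality of 3. *)
have G1 : G 1%:M by case: hG.
case: hstep => _ /(_ 0%N) hmin; suff /hmin : lie_algebra G = [set 0] by [].
have eq0 (A B : 'M[R[i]]_0) : A = B by apply/matrixP => -[].
by apply/seteqP; split => X _ //=; move=> t; rewrite (eq0 (mexp _) 1%:M).
Qed.
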